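(* Let $D$ be a domain in $\mathbb{C}$ with $C^2$ boundary near a point $p\in\partial D$, and let $f:D\to D$ be a holomorphic map. If $f(z)=z+o(|z-p|)$ as $z\to p$ non-tangentially, then either $f(z)\equiv z$, or $$f^k\to p,\qquad \limsup_{z\to p\ \text{non-tangentially}}\frac{|f(z)-z|}{|z-p|^3}>0,$$ where $f^k$ is the $k$-th iterate of $f$ and the convergence is uniform on compact subsets of $D$.
   Context: For $M>1$ let $\Gamma_M(p)=\{z\in D: |z-p|<M\,\mathrm{dist}(z,\partial D)\}$. A statement $g(z)=o(h(z))$ as $z\to p$ non-tangentially means that for every $M>1$, $g(z)/h(z)\to0$ as $z\to p$ within $\Gamma_M(p)$. The statement that $\limsup_{z\to p\ \text{non-tangentially}} u(z)>0$ for a function $u\ge 0$ means that it is not the case that $u(z)\to0$ as $z\to p$ non-tangentially, i.e. for some $M>1$ the limsup of $u(z)$ as $z\to p$ within $\Gamma_M(p)$ is positive. *)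

(* Defs.v *)
From HB Require Import structures.
From mathcomp Require Import all_boot all_order all_algebra.
From mathcomp Require Import all_classical all_reals all_analysis.
From mathcomp Require Import complex.

Set Implicit Arguments.
Unset Strict Implicit.
Unset Printing Implicit Defensive.

Import Order.TTheory GRing.Theory Num.Theory.
Import numFieldNormedType.Exports.

Local Open Scope classical_set_scope.
Local Open Scope ring_scope.

(* MathComp-Analysis equips a concrete field such as R[i] with its topology
   (and its structure of normed module over itself) on the alias R[i]^o.
   There, the norm `|z| is a nonnegative element of R[i]; the modulus as an
   element of R is normc z. *)
Notation Cplx R := (R[i]^o).
Notation normc := ComplexField.Normc.normc.

Section Defs.
Variable R : realType.
Implicit Types (A D K : set (Cplx R)) (p z : Cplx R) (f g h : Cplx R -> Cplx R).

Definition domain D : Prop := [/\ D !=set0, open D & connected D].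

Definition holomorphic_on D f : Prop :=
  forall z, D z -> derivable f z (1 : Cplx R).

Definition boundary A : set (Cplx R) := closure A `\` interior A.

Definition dist z A : R := inf [set normc (z - w) | w in A].

(* C^n on an open subset U of the plane: g and all its iterated partial
   derivatives of order at most n exist and are continuous at every point
   of U. *)
Fixpoint Cn_on (n : nat) (U : set (R * R)) (g : R * R -> R) : Prop :=
  (forall x, U x -> {for x, continuous g}) /\
  match n with
  | 0 => True
  | m.+1 => forall v : R * R, v = (1, 0) \/ v = (0, 1) ->
      (forall x, U x -> derivable g x v) /\ Cn_on m U ('D_v g)
  end.

Definition coords z : R * R := (complex.Re z, complex.Im z).

(* D has a C^2 local defining function r at p; in particular D lies locally
   on one side of its boundary, which is the curve r = 0. *)
Definition C2_boundary_near D p : Prop :=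
  exists (U : set (R * R)) (r : R * R -> R),
    [/\ open U /\ U (coords p),
        Cn_on 2 U r,
        forall x, U x -> ('D_(1, 0) r x, 'D_(0, 1) r x) != (0, 0) &
        forall z, U (coords z) -> (D z <-> r (coords z) < 0)].

Definition Gamma D p (M : R) : set (Cplx R) :=
  [set z | D z /\ normc (z - p) < M * dist z (boundary D)].

Definition nontangential D p (M : R) : set_system (Cplx R) :=
  within (Gamma D p M) (nbhs p).

Definition nt_littleo D p g h : Prop :=
  forall M : R, 1 < M ->
    (fun z => g z / h z : Cplx R) @ nontangential D p M --> (0 : Cplx R).

Definition nt_limsup_pos D p (u : Cplx R -> R) : Prop :=
  exists2 M : R, 1 < M &
    (0 < limf_esup (fun z => (u z)%:E) (nontangential D p M))%E.

Definition cvg_unif_on_compacts D (F : nat -> Cplx R -> Cplx R) f : Prop :=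
  forall K, compact K -> K `<=` D -> {uniform K, F @ \oo --> f}.

End Defs.

(* Main.v *)
Require Import Defs.
From mathcomp Require Import all_boot all_order all_algebra.
From mathcomp Require Import all_classical all_reals all_analysis.
From mathcomp Require Import complex ring lra.

Set Implicit Arguments.
Unset Strict Implicit.
Unset Printing Implicit Defensive.

Import Order.TTheory GRing.Theory Num.Theory.
Import numFieldNormedType.Exports.

Local Open Scope classical_set_scope.
Local Open Scope ring_scope.

(** Send p to infinity by w = nu / (z - p) + A, where nu is the inner unit
    normal at p. A C^2 boundary has an inner and an outer tangent disc at p, so
    for A large the image of D contains the half-plane {Re w > 2A} and lies in
    {Re w > 0} ([boundary_tangent_half_planes]). The iterates of f become
    holomorphic maps Phi k from the first half-plane to the second, and the
    hypothesis on f says that Phi 1 w / w tends to 1 in cones around the positive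
    real axis; it passes to every Phi k.

    By Julia's lemma ([julia]) no Phi k lowers the real part by more than a
    constant, hence Q k = Phi k - id + constant has positive real part and obeys
    the Schwarz-Pick lemma. The step of an orbit at time k differs from its first
    step by Q k (Phi 1 w) - Q k w, which is small compared with the first step as
    long as Re (Q k w) is small compared with Re w ([displacement_drift]). So
    the orbit of w runs along an almost straight line at an almost constant speed
    until it has travelled a distance comparable to Re w. Both conclusions rest on
    this.

    Convergence. If an orbit starting far out on the real axis returns infinitely
    often to a bounded set, its real parts are bounded; from a point where they
    almost attain their supremum the orbit can no longer advance, so its speed
    there is 0, and the same holds at all nearby points
    ([bounded_orbit_fixed]). Then f is the identity on an open set, hence on D.
    Otherwise Phi k tends to infinity on the ray, and the Harnack type inequality
    contained in the Schwarz-Pick lemma spreads this over the connected set D,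
    locally uniformly.

    Rate. Let w and w' be the points of the real axis at distances x and 4x from
    the edge of the half-plane. Run both orbits until the one of w has travelled a
    small fraction of x, in n steps say. Schwarz-Pick gives |Q n w'| >= |Q n w| / 4,
    and both orbits have moved at almost constant speed, so
    4 |Phi 1 w' - w'| >= (1 - small) |Phi 1 w - w| ([displacement_ratio]). Along
    x, 4x, 16x, ... the fractions can be chosen so that the losses form a
    convergent geometric series, and x |Phi 1 x - x| stays away from 0 on this
    sequence ([displacement_lower_bound]). In the coordinate z this quantity is
    comparable to |f z - z| / |z - p|^3.

    The function theory is derived from complex differentiability alone: Goursat's
    lemma for f (a + exp zeta) on rectangles gives the mean value inequality
    [re_circle_max], from which the maximum principle, the Schwarz and
    Schwarz-Pick lemmas and the identity theorem follow. *)

Local Notation normc0 := ComplexField.Normc.normc0.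
Local Notation normc1 := ComplexField.Normc.normc1.
Local Notation eq0_normc := ComplexField.Normc.eq0_normc.
Local Notation normcM := ComplexField.Normc.normcM.
Local Notation normcV := ComplexField.Normc.normcV.

(** * Modulus and complex derivatives in real epsilon-delta form *)

Section Modulus.
Variable R : realType.
Local Notation C := (Cplx R).
Implicit Types (z w : C).

Lemma normc_ge0 z : 0 <= normc z.
Proof. by case: z => a b /=; rewrite sqrtr_ge0. Qed.

Lemma normcB z w : normc (z - w) <= normc z + normc w.
Proof. by rewrite -(normcN w); exact: le_normcD. Qed.

Lemma normc_dist z w : normc (z - w) = normc (w - z).
Proof. by rewrite -normcN opprB. Qed.

Lemma normc_subr z w : normc z - normc w <= normc (z - w).
Proof. by rewrite lerBlDr; apply: le_trans (le_normcD _ _); rewrite subrK. Qed.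

Lemma normc_eq0 z : (normc z == 0) = (z == 0).
Proof.
apply/eqP/eqP => [|->]; first exact: eq0_normc.
exact: normc0.
Qed.

Lemma normc_gt0 z : (0 < normc z) = (z != 0).
Proof. by rewrite lt_neqAle normc_ge0 andbT eq_sym normc_eq0. Qed.

Lemma sqr_normcE z : normc z ^+ 2 = (complex.Re z) ^+ 2 + (complex.Im z) ^+ 2.
Proof. by case: z => a b /=; rewrite sqr_sqrtr // addr_ge0 // sqr_ge0. Qed.

Lemma Re_normc z : `|complex.Re z| <= normc z.
Proof.
rewrite -(@ler_pXn2r _ 2) ?nnegrE ?normc_ge0 // real_normK ?num_real //.
by rewrite sqr_normcE lerDl sqr_ge0.
Qed.

Lemma Im_normc z : `|complex.Im z| <= normc z.
Proof.
rewrite -(@ler_pXn2r _ 2) ?nnegrE ?normc_ge0 // real_normK ?num_real //.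
by rewrite sqr_normcE lerDr sqr_ge0.
Qed.

Lemma normc_ReIm z : normc z <= `|complex.Re z| + `|complex.Im z|.
Proof.
rewrite -(@ler_pXn2r _ 2) ?nnegrE ?normc_ge0 ?addr_ge0 // sqr_normcE.
rewrite sqrrD !real_normK ?num_real // lerD2r lerDl.
by rewrite mulrn_wge0 // mulr_ge0.
Qed.

Lemma normcR (x : R) : normc (x%:C)%C = `|x|.
Proof. by rewrite /= expr0n /= addr0 sqrtr_sqr. Qed.

Lemma normc_nat n : normc (n%:R : C) = n%:R.
Proof.
have -> : n%:R = (n%:R%:C)%C :> C by rewrite rmorph_nat.
by rewrite normcR ger0_norm.
Qed.

Lemma cReD z w : complex.Re (z + w) = complex.Re z + complex.Re w.
Proof. by case: z => a b; case: w => c d. Qed.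
Lemma cImD z w : complex.Im (z + w) = complex.Im z + complex.Im w.
Proof. by case: z => a b; case: w => c d. Qed.
Lemma cReN z : complex.Re (- z) = - complex.Re z.
Proof. by case: z. Qed.
Lemma cImN z : complex.Im (- z) = - complex.Im z.
Proof. by case: z. Qed.
Lemma cReM z w : complex.Re (z * w) =
  complex.Re z * complex.Re w - complex.Im z * complex.Im w.
Proof. by case: z => a b; case: w => c d. Qed.
Lemma cImM z w : complex.Im (z * w) =
  complex.Re z * complex.Im w + complex.Im z * complex.Re w.
Proof. by case: z => a b; case: w => c d. Qed.

Lemma complex_ext z w : complex.Re z = complex.Re w ->
  complex.Im z = complex.Im w -> z = w.
Proof. by case: z => a b; case: w => c d /= -> ->. Qed.

Lemma cReJ z : complex.Re (z^*)%C = complex.Re z.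
Proof. by case: z. Qed.
Lemma cImJ z : complex.Im (z^*)%C = - complex.Im z.
Proof. by case: z. Qed.
Lemma cnormJ z : normc (z^*)%C = normc z.
Proof. by case: z => a b /=; rewrite sqrrN. Qed.

Lemma gt0_complexE (e : C) : 0 < e -> e = ((complex.Re e)%:C)%C /\ 0 < complex.Re e.
Proof. by rewrite ltcE /=; case: e => a b /= /andP[/eqP -> ->]. Qed.

(** The norm of R[i] takes values in R[i]; this and the next lemmas trade it for
    the real-valued modulus, so that all estimates below take place in R. *)
Lemma nbhs_normcP z (P : set C) :
  nbhs z P <-> exists2 r : R, 0 < r & forall w, normc (w - z) < r -> P w.
Proof.
split=> [/nbhs_ballP[e /= /gt0_complexE[-> e0] be]|[r r0 rP]].
  exists (complex.Re e) => // w wz; apply: be.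
  rewrite -ball_normE /ball_ /=.
  change (((normc (z - w))%:C)%C < (((complex.Re e)%:C)%C : R[i])).
  by rewrite ltcR normc_dist.
apply/nbhs_ballP; exists (r%:C)%C => /=; first by rewrite ltcR.
move=> w; rewrite -ball_normE /ball_ /= => zw; apply: rP.
move: zw; change ((((normc (z - w))%:C)%C < ((r%:C)%C : R[i])) -> normc (w - z) < r).
by rewrite ltcR normc_dist.
Qed.

Lemma openP_normc (D : set C) : open D -> forall z, D z ->
  exists2 r : R, 0 < r & forall w, normc (w - z) < r -> D w.
Proof.
rewrite openE => oD z Dz; apply/nbhs_normcP; exact: oD.
Qed.

Lemma cvg_normcP (T : Type) (F : set_system T) {FF : Filter F} (f : T -> C) (l : C) :
  f @ F --> l <-> forall e : R, 0 < e -> \forall x \near F, normc (f x - l) < e.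
Proof.
split=> [fl e e0|h].
  by apply: (fl [set w | normc (w - l) < e]); apply/nbhs_normcP; exists e.
move=> P /nbhs_normcP[r r0 rP]; near=> x; apply: rP; near: x; exact: h.
Unshelve. all: by end_near. Qed.

Lemma continuous_normcP (f : C -> C) z : {for z, continuous f} <->
  forall e : R, 0 < e -> exists2 r : R, 0 < r &
    forall w, normc (w - z) < r -> normc (f w - f z) < e.
Proof.
split=> [fz e e0|h].
  exact/nbhs_normcP/((@cvg_normcP _ (nbhs z) _ f (f z)).1 fz e e0).
by apply/(@cvg_normcP _ (nbhs z) _ f (f z)) => e e0; apply/nbhs_normcP/h.
Qed.

Definition cderiv_at (f : C -> C) z (d : C) := forall e : R, 0 < e -> exists2 r : R, 0 < r &
    forall w, normc (w - z) < r ->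
    normc (f w - f z - d * (w - z)) <= e * normc (w - z).

Lemma derivable_cderiv (f : C -> C) z :
  derivable f z (1 : C) <-> exists d, cderiv_at f z d.
Proof.
rewrite /derivable; split=> [|[d fd]].
  case/cvg_ex => d /(@cvg_normcP _ (0 : C)^' _ _ d) fd; exists d => e e0.
  have := fd _ e0; rewrite near_withinE => /nbhs_normcP[r r0 H]; exists r => // w wz.
  have [->|wz0] := eqVneq w z.
    by rewrite !subrr mulr0 subrr (_ : normc 0 = 0) ?mulr0 //; apply/eqP; rewrite normc_eq0.
  have wz1 : w - z != 0 by rewrite subr_eq0.
  have := H (w - z); rewrite subr0 => /(_ wz wz1).
  rewrite /= scaler1 subrK => /ltW.
  rewrite -(ler_pM2r (_ : 0 < normc (w - z))) ?normc_gt0 //.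
  rewrite -normcM; congr (normc _ <= _).
  rewrite /GRing.scale /=. field. exact: wz1.
apply/cvg_ex; exists d; apply/(@cvg_normcP _ (0 : C)^' _ _ d) => e e0.
rewrite near_withinE.
have e20 : 0 < e / 2 by rewrite divr_gt0.
have [r r0 H] := fd _ e20.
apply/nbhs_normcP; exists r => // h; rewrite subr0 => hr h0.
have := H (h + z); rewrite addrK => /(_ hr) le2.
rewrite /= scaler1.
have h1 : 0 < normc h by rewrite normc_gt0.
rewrite -(ltr_pM2r h1) -normcM.
have -> : (h^-1 *: (f (h + z) - f z) - d) * h = f (h + z) - f z - d * h.
  rewrite /GRing.scale /=. field. exact: h0.
apply: le_lt_trans le2 _. rewrite ltr_pM2r //. by rewrite ltr_pdivrMr // mulr_natr mulr2n ltrDl.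
Qed.

End Modulus.

(** * Primitives and increments of functions of one real variable *)

Section RealIncrements.
Variable R : realType.
Local Notation C := (Cplx R).

Lemma primitive_exists (f : R -> R) (a b : R) :
  (forall x, a <= x <= b -> {for x, continuous f}) ->
  exists P : R -> R, forall x, a < x < b -> is_derive x (1 : R) P (f x).
Proof.
move=> cf; exists (fun x => \int[lebesgue_measure]_(t in `[a, x]) f t)%R.
move=> x /andP[ax xb].
have int : lebesgue_measure.-integrable `[a, b] (EFin \o f).
  apply: continuous_compact_integrable; first exact: segment_compact.
  apply: continuous_in_subspaceT => y /set_mem /=; rewrite in_itv /=; exact: cf.
have cx : {for x, continuous f} by apply: cf; rewrite !ltW.
have [dP <-] := @continuous_FTC1_closed R f a x b xb int ax cx.
by rewrite derive1E; exact: derivableP.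
Qed.

Lemma increment_mvt (P f : R -> R) (lo hi a b : R) :
  (forall x, lo < x < hi -> is_derive x (1 : R) P (f x)) ->
  lo < a -> a <= b -> b < hi ->
  exists2 c, a <= c <= b & P b - P a = f c * (b - a).
Proof.
move=> dP loa; rewrite le_eqVlt => /orP[/eqP <-|ab] bhi.
  by exists a; rewrite ?lexx // !subrr mulr0.
have dP' x : x \in `]a, b[ -> is_derive x (1 : R) P (f x).
  rewrite in_itv /= => /andP[ax xb]; apply: dP.
  by rewrite (lt_trans loa) //= (lt_trans xb).
have cP : {within `[a, b], continuous P}.
  apply: continuous_in_subspaceT => y /set_mem /=; rewrite in_itv /= => /andP[ay yb].
  have : is_derive y (1 : R) P (f y).
    by apply: dP; rewrite (lt_le_trans loa) //= (le_lt_trans yb).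
  by case=> dy _; apply/differentiable_continuous/derivable1_diffP.
have [c] := MVT ab dP' cP; rewrite in_itv /= => /andP[ac cb] ->.
by exists c; rewrite ?ltW.
Qed.

Lemma increment_bound (P f : R -> R) (lo hi a b k e : R) :
  (forall x, lo < x < hi -> is_derive x (1 : R) P (f x)) ->
  lo < a -> a <= b -> b < hi ->
  (forall x, a <= x <= b -> `|f x - k| <= e) ->
  `|P b - P a - k * (b - a)| <= e * (b - a).
Proof.
move=> dP loa ab bhi fk; have [c cab ->] := increment_mvt dP loa ab bhi.
by rewrite -mulrBl normrM (ger0_norm (_ : 0 <= b - a)) ?subr_ge0 // ler_wpM2r ?subr_ge0 ?fk.
Qed.

End RealIncrements.

(** * Rectangle functions that vanish by subdivision *)

Section Subdivision.
Variable R : realType.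

(** Goursat's argument, freed from integrals: an additive rectangle function
    which is o(diameter^2) at every point is 0. Otherwise some quarter of the
    rectangle keeps a quarter of its value, and quartering forever contradicts
    the estimate at the common point of the nested rectangles. *)
Lemma subdivision_vanish (J : R -> R -> R -> R -> R) (a b c d : R) :
  a < b -> c < d ->
  (forall x m x' y y', J x x' y y' = J x m y y' + J m x' y y') ->
  (forall x x' y m y', J x x' y y' = J x x' y m + J x x' m y') ->
  (forall p q, a <= p <= b -> c <= q <= d -> forall e : R, 0 < e ->
    exists2 r : R, 0 < r & forall x x' y y',
      a <= x -> x <= p <= x' -> x' <= b -> c <= y -> y <= q <= y' -> y' <= d ->
      (x' - x) + (y' - y) < r ->
      `|J x x' y y'| <= e * ((x' - x) + (y' - y)) ^+ 2) ->
  J a b c d = 0.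
Proof.
move=> ab cd Jx Jy Jloc.
have [w bE] : exists w, b = a + w by exists (b - a); rewrite addrC subrK.
have [h dE] : exists h, d = c + h by exists (d - c); rewrite addrC subrK.
subst b d.
have w0 : 0 < w by rewrite ltrDl in ab.
have h0 : 0 < h by rewrite ltrDl in cd.
pose Q n (s : R * R) := J s.1 (s.1 + w / 2 ^+ n) s.2 (s.2 + h / 2 ^+ n).
have half (v : R) n : v / 2 ^+ n = v / 2 ^+ n.+1 + v / 2 ^+ n.+1.
  by rewrite exprS; field; rewrite expf_neq0 ?pnatr_eq0.
(* A rectangle of generation n is determined by its lower left corner, and one of
   its four quarters carries at least a quarter of its value. *)
have step (ns : nat * (R * R)) : exists t : R * R,
    [/\ ns.2.1 <= t.1 <= ns.2.1 + w / 2 ^+ ns.1.+1,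
        ns.2.2 <= t.2 <= ns.2.2 + h / 2 ^+ ns.1.+1 &
        `|Q ns.1 ns.2| <= 4 * `|Q ns.1.+1 t| ].
  case: ns => n [x y] /=.
  set dx := w / 2 ^+ n.+1; set dy := h / 2 ^+ n.+1.
  have dx0 : 0 <= dx by rewrite divr_ge0 ?exprn_ge0 ?ltW.
  have dy0 : 0 <= dy by rewrite divr_ge0 ?exprn_ge0 ?ltW.
  have QE : Q n (x, y) = Q n.+1 (x, y) + Q n.+1 (x + dx, y) +
      (Q n.+1 (x, y + dy) + Q n.+1 (x + dx, y + dy)).
    rewrite /Q /= -/dx -/dy !(half _ n) -/dx -/dy !addrA.
    by rewrite (Jy _ _ _ (y + dy)) 2!(Jx x (x + dx) (x + dx + dx)) !addrA.
  apply: contrapT => /forallNP H.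
  have lt4 t : x <= t.1 <= x + dx -> y <= t.2 <= y + dy -> 4 * `|Q n.+1 t| < `|Q n (x, y)|.
    by move=> t1 t2; rewrite ltNge; apply/negP => ?; exact: (H t).
  have := lt4 (x, y); have := lt4 (x + dx, y); have := lt4 (x, y + dy).
  have := lt4 (x + dx, y + dy) => /=.
  rewrite !lexx !lerDl dx0 dy0 /= => /(_ isT isT) h1 /(_ isT isT) h2 /(_ isT isT) h3 /(_ isT isT) h4.
  have := ler_normD (Q n.+1 (x, y) + Q n.+1 (x + dx, y)) (Q n.+1 (x, y + dy) + Q n.+1 (x + dx, y + dy)).
  have := ler_normD (Q n.+1 (x, y)) (Q n.+1 (x + dx, y)).
  have := ler_normD (Q n.+1 (x, y + dy)) (Q n.+1 (x + dx, y + dy)).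
  rewrite -QE; lra.
have [nx nxP] := choice step.
pose s := fix s n := if n is m.+1 then nx (m, s m) else (a, c).
have sS n : s n.+1 = nx (n, s n) by [].
pose X n := (s n).1; pose Y n := (s n).2.
have XS n : X n <= X n.+1 /\ X n.+1 + w / 2 ^+ n.+1 <= X n + w / 2 ^+ n.
  have [/andP[h1 h2] _ _] := nxP (n, s n); rewrite /X sS; split=> //.
  by rewrite (half _ n) addrA lerD2r.
have YS n : Y n <= Y n.+1 /\ Y n.+1 + h / 2 ^+ n.+1 <= Y n + h / 2 ^+ n.
  have [_ /andP[h1 h2] _] := nxP (n, s n); rewrite /Y sS; split=> //.
  by rewrite (half _ n) addrA lerD2r.
have nested (Z : nat -> R) (v : R) : 0 < v ->
    (forall n, Z n <= Z n.+1 /\ Z n.+1 + v / 2 ^+ n.+1 <= Z n + v / 2 ^+ n) ->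
    [/\ exists p, forall n, Z n <= p <= Z n + v / 2 ^+ n,
     forall n, Z 0%N <= Z n & forall n, Z n + v / 2 ^+ n <= Z 0%N + v].
  move=> v0 ZS.
  have up m k : Z m <= Z (m + k)%N.
    elim: k => [|k IH]; rewrite ?addn0 // addnS.
    exact: le_trans IH (ZS _).1.
  have dn m k : Z (m + k)%N + v / 2 ^+ (m + k) <= Z m + v / 2 ^+ m.
    elim: k => [|k IH]; rewrite ?addn0 // addnS.
    exact: le_trans (ZS _).2 IH.
  have vn n : 0 < v / 2 ^+ n by rewrite divr_gt0 // exprn_gt0.
  have cross m n : Z m <= Z n + v / 2 ^+ n.
    case: (leqP m n) => [mn|/ltnW nm].
      have := up m (n - m)%N; rewrite subnKC // => /le_trans; apply.
      by rewrite lerDl ltW.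
    have := dn n (m - n)%N; rewrite subnKC //; apply: le_trans.
    by rewrite lerDl ltW.
  split; last 2 first.
  - by move=> n; have := up 0%N n; rewrite add0n.
  - by move=> n; have := dn 0%N n; rewrite add0n expr0 divr1.
  exists (sup (range Z)) => n; apply/andP; split.
    apply: ub_le_sup; last by exists n.
    by exists (Z 0%N + v / 2 ^+ 0) => _ [m _ <-].
  apply: ge_sup; first by exists (Z 0%N), 0%N.
  by move=> _ [m _ <-].
have [[p pP] X0 X1] := nested X w w0 XS.
have [[q qP] Y0 Y1] := nested Y h h0 YS.
have JQ n : `|J a (a + w) c (c + h)| <= 4 ^+ n * `|Q n (s n)|.
  elim: n => [|n IH].
    by rewrite expr0 mul1r /Q /= !expr0 !divr1.
  apply: le_trans IH _; rewrite exprSr -mulrA ler_pM2l ?exprn_gt0 //.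
  by have [_ _] := nxP (n, s n).
apply/eqP; rewrite -normr_le0 leNgt; apply/negP => J0.
set e := `|J a (a + w) c (c + h)| / (2 * (w + h) ^+ 2).
have wh : 0 < w + h by rewrite addr_gt0.
have e0 : 0 < e by rewrite divr_gt0 // mulr_gt0 // exprn_gt0.
have pab : a <= p <= a + w.
  by have := pP 0%N; rewrite expr0 divr1.
have qcd : c <= q <= c + h.
  by have := qP 0%N; rewrite expr0 divr1.
have [r r0 H] := Jloc p q pab qcd e e0.
have [n nr] : exists n : nat, (w + h) / r < 2 ^+ n.
  exists (Num.truncn ((w + h) / r)).+1.
  apply: lt_le_trans (truncnS_gt _) _.
  by rewrite -natrX ler_nat ltnW // ltn_expl.
have p2 : 0 < 2 ^+ n :> R by rewrite exprn_gt0.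
have := H (X n) (X n + w / 2 ^+ n) (Y n) (Y n + h / 2 ^+ n).
have -> : X n + w / 2 ^+ n - X n + (Y n + h / 2 ^+ n - Y n) = (w + h) / 2 ^+ n.
  by rewrite !(addrC _ (_ / _)) !addrK mulrDl.
move=> /(_ (X0 n) (pP n)).
move=> /(_ (X1 n) (Y0 n) (qP n) (Y1 n)).
rewrite ltr_pdivrMr // mulrC -ltr_pdivrMr // => /(_ nr) le1.
have := JQ n; rewrite leNgt => /negP; apply.
apply: (@le_lt_trans _ _ (4 ^+ n * (e * ((w + h) / 2 ^+ n) ^+ 2))).
  by rewrite ler_pM2l ?exprn_gt0.
have -> : 4 ^+ n * (e * ((w + h) / 2 ^+ n) ^+ 2) = `|J a (a + w) c (c + h)| / 2.
  have -> : 4 = 2 ^+ 2 :> R by rewrite -natrX.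
  rewrite /e -exprM mulnC exprM; field.
  by rewrite ?lt0r_neq0 ?expf_neq0.
by rewrite ltr_pdivrMr // mulr_natr mulr2n ltrDl.
Qed.

End Subdivision.

(** * Goursat's lemma on rectangles *)

Section Goursat.
Variable R : realType.
Local Notation C := (Cplx R).

Lemma derivable_continuous (f : C -> C) z : derivable f z (1 : C) -> {for z, continuous f}.
Proof. by move=> /derivable1_diffP/differentiable_continuous. Qed.

Lemma continuous_line (g : C -> C) (l : R -> C) (t : R) (k : C -> R) :
  (forall t', normc (l t' - l t) <= `|t' - t|) ->
  (forall z w, `|k z - k w| <= normc (z - w)) ->
  {for l t, continuous g} -> {for t, continuous (fun t' => k (g (l t')))}.
Proof.
move=> lP kP /continuous_normcP gc; apply/cvgrPdist_lt => e e0.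
have [r r0 H] := gc e e0.
near=> t'; rewrite distrC; apply: le_lt_trans (kP _ _) _; apply: H.
apply: le_lt_trans (lP _) _; rewrite distrC; near: t'.
by apply/nbhs_normP; exists r.
Unshelve. all: by end_near. Qed.

Lemma Re_lip (z w : C) : `|complex.Re z - complex.Re w| <= normc (z - w).
Proof. by rewrite -cReN -cReD; exact: Re_normc. Qed.

Lemma Im_lip (z w : C) : `|complex.Im z - complex.Im w| <= normc (z - w).
Proof. by rewrite -cImN -cImD; exact: Im_normc. Qed.

Lemma vline_dist (x y y' : R) :
  normc ((x +i* y')%C - (x +i* y)%C : C) <= `|y' - y|.
Proof.
have := normc_ReIm ((x +i* y')%C - (x +i* y)%C).
by rewrite /= subrr normr0 add0r.
Qed.

Lemma hline_dist (x x' y : R) :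
  normc ((x' +i* y)%C - (x +i* y)%C : C) <= `|x' - x|.
Proof.
have := normc_ReIm ((x' +i* y)%C - (x +i* y)%C).
by rewrite /= subrr normr0 addr0.
Qed.

(** Instead of integrals, fix primitives: U x of Re g along the vertical line
    through x, and V y of Im g along the horizontal line through y. The last
    equation then says that the imaginary part of the integral of g dz over the
    boundary of a rectangle is 0, which compares the integrals of Re g along two
    vertical segments. *)
Lemma goursat (g : C -> C) (a0 b0 c0 d0 : R) :
  (forall x y, a0 <= x <= b0 -> c0 <= y <= d0 -> derivable g (x +i* y)%C (1 : C)) ->
  exists U V : R -> R -> R, [/\
    forall x y, a0 <= x <= b0 -> c0 < y < d0 ->
      is_derive y (1 : R) (U x) (complex.Re (g (x +i* y)%C)),
    forall x y, a0 < x < b0 -> c0 <= y <= d0 ->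
      is_derive x (1 : R) (V y) (complex.Im (g (x +i* y)%C)) &
    forall a b c d, a0 < a -> a < b -> b < b0 -> c0 < c -> c < d -> d < d0 ->
      V c b - V c a - (V d b - V d a) + (U b d - U b c) - (U a d - U a c) = 0].
Proof.
move=> dg.
have Uex x : exists P : R -> R, a0 <= x <= b0 -> forall y, c0 < y < d0 ->
      is_derive y (1 : R) P (complex.Re (g (x +i* y)%C)).
  case: (boolP (a0 <= x <= b0)) => [xab|_]; last by exists id.
  have [|P HP] := @primitive_exists R (fun y => complex.Re (g (x +i* y)%C)) c0 d0.
    move=> y ycd; apply: (@continuous_line g (fun y => (x +i* y)%C)) => [y'||].
    - exact: vline_dist.
    - exact: Re_lip.
    - exact: derivable_continuous (dg _ _ _ _).
  by exists P.
have Vex y : exists P : R -> R, c0 <= y <= d0 -> forall x, a0 < x < b0 ->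
      is_derive x (1 : R) P (complex.Im (g (x +i* y)%C)).
  case: (boolP (c0 <= y <= d0)) => [ycd|_]; last by exists id.
  have [|P HP] := @primitive_exists R (fun x => complex.Im (g (x +i* y)%C)) a0 b0.
    move=> x xab; apply: (@continuous_line g (fun x => (x +i* y)%C)) => [x'||].
    - exact: hline_dist.
    - exact: Im_lip.
    - exact: derivable_continuous (dg _ _ _ _).
  by exists P.
have [U UP] := choice Uex; have [V VP] := choice Vex.
exists U, V; split=> [x y xab ycd|x y xab ycd|a b c d a0a ab bb0 c0c cd dd0].
- exact: UP.
- exact: VP.
pose J a b c d := V c b - V c a - (V d b - V d a) + (U b d - U b c) - (U a d - U a c).
rewrite -/(J a b c d).
apply: subdivision_vanish => // [x m x' y y'|x x' y m y'|p q pab qcd e e0].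
- by rewrite /J; ring.
- by rewrite /J; ring.
have /derivable_cderiv[D gD] : derivable g (p +i* q)%C (1 : C).
  by apply: dg; lra.
have e20 : 0 < e / 2 by rewrite divr_gt0.
(* The affine part of g contributes nothing to J: its two contributions below,
   with the factor Re D, cancel. The rest is at most e L / 2 at each point. *)
have [r r0 H] := gD _ e20; exists r => // x x' y y' ax /andP[xp px'] x'b cy /andP[yq qy'] y'd Lr.
set L := x' - x + (y' - y) in Lr *.
have dist s t : x <= s <= x' -> y <= t <= y' ->
    normc ((s +i* t)%C - (p +i* q)%C : C) <= L.
  move=> st tt; have /= := normc_ReIm ((s +i* t)%C - (p +i* q)%C).
  move=> /le_trans; apply.
  by rewrite /L lerD // ler_norml; lra.
have near s t : x <= s <= x' -> y <= t <= y' ->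
    normc (g (s +i* t)%C - g (p +i* q)%C - D * ((s +i* t)%C - (p +i* q)%C)) <= e / 2 * L.
  move=> st tt; have dL := dist s t st tt.
  apply: le_trans (H _ (le_lt_trans dL Lr)) _.
  by rewrite ler_pM2l.
have L0 : 0 <= L by rewrite /L; move: xp px' yq qy'; clear; lra.
have e2L : 0 <= e / 2 * L by rewrite mulr_ge0 // ltW.
have L1 : `|(fun s => V y s - V y' s) x' - (fun s => V y s - V y' s) x
            - complex.Re D * (y - y') * (x' - x)| <= (e * L) * (x' - x).
  refine (@increment_bound R (fun s => V y s - V y' s)
    (fun s => complex.Im (g (s +i* y)%C) - complex.Im (g (s +i* y')%C))
    a0 b0 x x' _ (e * L) _ _ _ _ _).
  - move=> s sab; apply: is_deriveB; apply: VP; lra.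
  - lra.
  - lra.
  - lra.
  - move=> s st.
    have n1 := near s y st; have n2 := near s y' st.
    have := le_trans (Im_normc _) (n1 ltac:(lra)).
    have := le_trans (Im_normc _) (n2 ltac:(lra)).
    rewrite !cImD !cImN !cImM /= !ler_norml; nra.
have L2 : `|(fun t => U x' t - U x t) y' - (fun t => U x' t - U x t) y
            - complex.Re D * (x' - x) * (y' - y)| <= (e * L) * (y' - y).
  refine (@increment_bound R (fun t => U x' t - U x t)
    (fun t => complex.Re (g (x' +i* t)%C) - complex.Re (g (x +i* t)%C))
    c0 d0 y y' _ (e * L) _ _ _ _ _).
  - move=> s sab; apply: is_deriveB; apply: UP; lra.
  - lra.
  - lra.
  - lra.
  - move=> t tt.
    have n1 := near x t ltac:(lra) tt; have n2 := near x' t ltac:(lra) tt.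
    have := le_trans (Re_normc _) n1.
    have := le_trans (Re_normc _) n2.
    rewrite !cReD !cReN !cReM /= !ler_norml; nra.
have -> : e * L ^+ 2 = e * L * (x' - x) + e * L * (y' - y) by rewrite /L; ring.
have -> : J x x' y y' = (V y x' - V y' x' - (V y x - V y' x) - complex.Re D * (y - y') * (x' - x))
   + (U x' y' - U x y' - (U x' y - U x y) - complex.Re D * (x' - x) * (y' - y)).
  by rewrite /J; ring.
exact: le_trans (ler_normD _ _) (lerD L1 L2).
Qed.

End Goursat.

(** * The complex exponential *)

Section ComplexExponential.
Variable R : realType.
Local Notation C := (Cplx R).

Lemma is_derive_eps (f : R -> R) (x d : R) : is_derive x (1 : R) f d ->
  forall e : R, 0 < e -> exists2 r : R, 0 < r & forall h, `|h| < r ->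
    `|f (x + h) - f x - d * h| <= e * `|h|.
Proof.
case=> /derivableP[] /cvg_ex[l fl] _ dE e e0.
have El : l = d by rewrite -dE /derive; apply/esym/cvg_lim.
rewrite {l}El in fl.
move/cvgrPdist_lt : fl => /(_ e e0).
rewrite near_withinE => /nbhs_ballP[r /= r0 H]; exists r => // h hr.
have [->|h0] := eqVneq h 0; first by rewrite addr0 subrr mulr0 subr0 normr0 mulr0.
have := H h; rewrite -ball_normE /= sub0r normrN => /(_ hr h0) /ltW.
have h1 : 0 < `|h| by rewrite normr_gt0.
rewrite -(ler_pM2r h1) -normrM => H2.
rewrite -normrN; suff -> : - (f (x + h) - f x - d * h) =
  (d - h^-1 *: (f (h *: 1 + x) - f x)) * h by [].
rewrite /GRing.scale /= mulr1 (addrC h); field; exact: h0.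
Qed.

Definition cexp (z : C) : C :=
  (expR (complex.Re z) * cos (complex.Im z) +i* (expR (complex.Re z) * sin (complex.Im z)))%C.

Lemma cexpD z w : cexp (z + w) = cexp z * cexp w.
Proof.
apply: complex_ext; rewrite /cexp ?cReM ?cImM /= ?cReD ?cImD expRD ?cosD ?sinD; ring.
Qed.

Lemma normc_cexp z : normc (cexp z) = expR (complex.Re z).
Proof.
rewrite /cexp /= !exprMn -mulrDr cos2Dsin2 mulr1 sqrtr_sqr ger0_norm // expR_ge0.
Qed.

(** The case z = 0 is the one that needs the real expansions of expR, cos and
    sin; the functional equation moves it to every point. *)
Lemma cexp_deriv0 : cderiv_at cexp 0 1.
Proof.
move=> e e0.
have [e' [e'0 e'1 e'9]] : exists e' : R, [/\ 0 < e', e' <= 1 & 9 * e' <= e].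
  exists (Num.min (e / 9) 1); split.
  - by rewrite lt_min ltr01 andbT divr_gt0.
  - by rewrite ge_min lexx orbT.
  - by rewrite mulrC -ler_pdivlMr // ge_min lexx.
have [r1 r10 H1] := is_derive_eps (is_derive_expR 0) e'0.
have [r2 r20 H2] := is_derive_eps (is_derive_cos 0) e'0.
have [r3 r30 H3] := is_derive_eps (is_derive_sin 0) e'0.
exists (Num.min (Num.min r1 r2) (Num.min r3 e')) => [|w].
  by rewrite !lt_min r10 r20 r30 e'0.
rewrite !subr0 mul1r !lt_min => /andP[/andP[w1 w2] /andP[w3 w4]].
have sw := Re_normc w; have tw := Im_normc w.
have := H1 _ (le_lt_trans sw w1).
have := H2 _ (le_lt_trans tw w2).
have := H3 _ (le_lt_trans tw w3).
rewrite !add0r expR0 !cos0 !sin0 !mul1r oppr0 mul0r !subr0 ?addr0.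
have -> : cexp 0 = 1.
  by apply: complex_ext; rewrite /cexp /= expR0 ?cos0 ?sin0 mul1r.
have n0 := normc_ge0 w; set n : R := normc w in sw tw w4 n0 *.
have := normc_ReIm (cexp w - 1 - w); move=> h h3 h2 h1; apply: le_trans h _.
rewrite !cReD !cReN !cImD !cImN /= oppr0 addr0.

move: (complex.Re w) (complex.Im w) sw tw h1 h2 h3 => s t sw tw.
set E := expR s; set c := cos t; set S := sin t => h1 h2 h3.
have c1 : `|c| <= 1 by rewrite ler_norml cos_le1 cos_geN1.
have -> : E * c - 1 - s = (E - 1 - s) * c + (1 + s) * (c - 1) by ring.
have -> : E * S - t = (E - 1 - s) * S + s * S + (S - t) by ring.
have S1 : `|S| <= 2 * n.
  have -> : S = (S - t) + t by ring.
  apply: le_trans (ler_normD _ _) _.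
  have : e' * `|t| <= n by rewrite -[n]mul1r ler_pM // ltW.
  by lra.
have a1 : `|(E - 1 - s) * c| <= e' * n.
  rewrite normrM -[leRHS]mulr1 ler_pM //.
  by apply: le_trans h1 _; rewrite ler_pM2l.
have a2 : `|(1 + s) * (c - 1)| <= 2 * (e' * n).
  rewrite normrM ler_pM //.
    by apply: le_trans (ler_normD _ _) _; rewrite normr1; lra.
  by apply: le_trans h2 _; rewrite ler_pM2l.
have S2 : `|S| <= 1 by rewrite ler_norml sin_le1 sin_geN1.
have a3 : `|(E - 1 - s) * S| <= e' * n.
  rewrite normrM -[leRHS]mulr1 ler_pM //.
  by apply: le_trans h1 _; rewrite ler_pM2l.
have a4 : `|s * S| <= 2 * (e' * n).
  rewrite normrM.
  have : `|s| * `|S| <= n * (2 * n) by rewrite ler_pM.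
  have : n * n <= e' * n by rewrite ler_wpM2r // ltW.
  lra.
have a5 : `|S - t| <= e' * n by apply: le_trans h3 _; rewrite ler_pM2l.
have b1 := ler_normD ((E - 1 - s) * c) ((1 + s) * (c - 1)).
have b2 := ler_normD ((E - 1 - s) * S + s * S) (S - t).
have b3 := ler_normD ((E - 1 - s) * S) (s * S).
have : 9 * e' * n <= e * n by rewrite ler_wpM2r.
have : 0 <= e' * n by rewrite mulr_ge0 // ltW.
lra.
Qed.

Lemma cexp_deriv z : cderiv_at cexp z (cexp z).
Proof.
move=> e e0.
have N0 : 0 < normc (cexp z) by rewrite normc_cexp expR_gt0.
have [r r0 H] := cexp_deriv0 (divr_gt0 e0 N0).
exists r => // w wz.
have := H (w - z); rewrite !subr0 => /(_ wz).
rewrite mulrAC ler_pdivlMr // mulrC -normcM.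
rewrite mul1r !mulrBr -cexpD.
have -> : z + (w - z) = w by rewrite addrC subrK.
have -> : cexp 0 = 1.
  by apply: complex_ext; rewrite /cexp /= expR0 ?cos0 ?sin0 mul1r.
by rewrite mulr1.
Qed.

Lemma derivable_cexp z : derivable cexp z (1 : C).
Proof. by apply/derivable_cderiv; exists (cexp z); exact: cexp_deriv. Qed.

End ComplexExponential.

(** * Mean values on circles *)

Section CircleMean.
Variable R : realType.
Local Notation C := (Cplx R).
Implicit Types (z w : C).

Lemma derivable_chain (f g : C -> C) z : derivable g z (1 : C) ->
  derivable f (g z) (1 : C) -> derivable (fun w => f (g w)) z (1 : C).
Proof.
move=> /derivable_cderiv[b gb] /derivable_cderiv[a fa].
apply/derivable_cderiv; exists (a * b) => e e0.
set K := 1 + normc b.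
have K0 : 0 < K by rewrite ltr_pwDl // normc_ge0.
have [r1 r10 H1] := fa _ (divr_gt0 (divr_gt0 e0 (ltr0n R 2)) K0).
set m := Num.min 1 (e / (2 * (1 + normc a))).
have a0 : 0 < 1 + normc a by rewrite ltr_pwDl // normc_ge0.
have m0 : 0 < m by rewrite lt_min ltr01 divr_gt0 // mulr_gt0.
have [r2 r20 H2] := gb _ m0.
exists (Num.min r2 (r1 / K)) => [|w]; first by rewrite lt_min r20 divr_gt0.
rewrite lt_min => /andP[w2 wK].
have G := H2 w w2.
have n0 := normc_ge0 (w - z).
have gw : normc (g w - g z) <= K * normc (w - z).
  have -> : g w - g z = (g w - g z - b * (w - z)) + b * (w - z) by rewrite subrK.
  apply: le_trans (le_normcD _ _) _; rewrite normcM /K mulrDl mul1r lerD2r.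
  by apply: le_trans G _; rewrite ler_piMl // ge_min lexx.
have gr : normc (g w - g z) < r1.
  by apply: le_lt_trans gw _; rewrite mulrC -ltr_pdivlMr.
have -> : f (g w) - f (g z) - a * b * (w - z) =
  (f (g w) - f (g z) - a * (g w - g z)) + a * (g w - g z - b * (w - z)) by ring.
apply: le_trans (le_normcD _ _) _; rewrite normcM.
have E1 : normc (f (g w) - f (g z) - a * (g w - g z)) <= e / 2 * normc (w - z).
  apply: le_trans (H1 _ gr) _; rewrite mulrAC ler_pdivrMr //.
  by rewrite -[leRHS]mulrA ler_pM2l ?divr_gt0 // [_ * K]mulrC.
have E2 : normc a * normc (g w - g z - b * (w - z)) <= e / 2 * normc (w - z).
  apply: (@le_trans _ _ ((1 + normc a) * (m * normc (w - z)))).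
    by apply: ler_pM => //; [exact: normc_ge0|exact: normc_ge0|rewrite lerDr].
  rewrite mulrA ler_wpM2r // mulrC -ler_pdivlMr //.
  by rewrite -mulrA -invfM ge_min lexx orbT.
have := lerD E1 E2; rewrite -mulrDl -splitr; exact.
Qed.

Lemma cderiv_near (f g : C -> C) z r : 0 < r ->
  (forall w, normc (w - z) < r -> f w = g w) ->
  derivable g z (1 : C) -> derivable f z (1 : C).
Proof.
move=> r0 fg /derivable_cderiv[d gd]; apply/derivable_cderiv; exists d => e e0.
have [s s0 H] := gd e e0; exists (Num.min r s); first by rewrite lt_min r0.
move=> w; rewrite lt_min => /andP[wr ws].
by rewrite !fg // ?subrr ?normc0 //; exact: H.
Qed.

(** In the coordinate zeta = log (z - a) the circles around a become vertical
    segments of length 2 pi, and a + exp zeta never takes the value a. Goursat's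
    lemma and periodicity show that the integral of Re f over the circle does not
    depend on its radius, and continuity at a identifies its limit. Allowing mere
    continuity at a makes the lemma applicable to difference quotients. *)
Lemma re_circle_max (f : C -> C) (a : C) (rho r M : R) :
  (forall z, 0 < normc (z - a) < rho -> derivable f z (1 : C)) ->
  {for a, continuous f} -> 0 < r -> r < rho ->
  (forall z, normc (z - a) = r -> complex.Re (f z) <= M) ->
  complex.Re (f a) <= M.
Proof.
move=> df /continuous_normcP cf r0 rrho fM.
apply/ler_addgt0Pr => e e0.
have [r1 r10 H1] := cf e e0.
pose s := ln r; pose s' := Num.min (s - 1) (ln (r1 / 2)).
have s's : s' < s by rewrite gt_min ltrBlDr ltrDl ltr01.
have es : expR s = r by rewrite /s lnK.
have es' : expR s' < r1.
  apply: (@le_lt_trans _ _ (r1 / 2)).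
    by rewrite -[leRHS]lnK ?posrE ?divr_gt0 // ler_expR ge_min lexx orbT.
  by rewrite ltr_pdivrMr // mulr_natr mulr2n ltrDl.
pose s0 := ln ((r + rho) / 2).
have rho0 : 0 < rho by exact: lt_trans r0 rrho.
have es0 : expR s0 = (r + rho) / 2 by rewrite /s0 lnK // posrE divr_gt0 // addr_gt0.
have ss0 : s < s0 by rewrite -ltr_expR es es0; lra.
have s0rho : expR s0 < rho by rewrite es0; lra.
pose g := fun z : C => f (a + cexp z).
have pi2 : 0 < 2 * pi :> R by rewrite mulr_gt0 // pi_gt0.
have dg x y : s' - 1 <= x <= s0 -> -1 <= y <= 2 * pi + 1 -> derivable g (x +i* y)%C (1 : C).
  move=> /andP[_ xs0] _.
  apply: (@derivable_chain f (fun z => a + cexp z)).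
    by apply: derivableD; [exact: derivable_cst|exact: derivable_cexp].
  apply: df; rewrite addrC addKr normc_cexp expR_gt0 /=.
  by apply: le_lt_trans s0rho; rewrite ler_expR.
have [U [V [UP VP JP]]] := goursat dg.
have := JP s' s 0 (2 * pi).
rewrite gtrBl ltr01 s's ss0 oppr_lt0 ltr01 pi2 ltrDl ltr01.
move=> /(_ isT isT isT isT isT isT).
(* By periodicity the two horizontal sides of the rectangle cancel. *)
have per x : g (x +i* (2 * pi))%C = g (x +i* 0)%C.
  rewrite /g /cexp /= sin0 cos0; congr (f (a + (_ +i* _)%C)).
    by rewrite mulr_natl cos2pi.
  by rewrite mulr_natl sin2pi.
have [||||x _ VE] := @increment_mvt R (fun x => V 0 x - V (2 * pi) x)
    (fun x => complex.Im (g (x +i* 0)%C) - complex.Im (g (x +i* (2 * pi))%C)) (s' - 1) s0 s' s.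
- move=> x xs; apply: is_deriveB; apply: VP => //.
  + by rewrite oppr_le0 ler01 /=; lra.
  + by apply/andP; split; lra.
- by rewrite gtrBl ltr01.
- exact: ltW.
- exact: ss0.
move: VE; rewrite per subrr mul0r => VE.
have ring1 t : s' - 1 <= t <= s0 -> exists2 y, complex.Re (f (a + cexp (t +i* y)%C)) * (2 * pi) =
    U t (2 * pi) - U t 0 & normc (cexp (t +i* y)%C) = expR t.
  move=> xs.
  have [||||c _ ->] := @increment_mvt R (U t) (fun y => complex.Re (g (t +i* y)%C)) (-1) (2 * pi + 1) 0 (2 * pi).
  - by move=> v vv; exact: UP.
  - by rewrite oppr_lt0.
  - exact: ltW.
  - by rewrite ltrDl.
  by exists c; rewrite ?subr0 ?normc_cexp.
have [|y1 E1 N1] := ring1 s; first by rewrite ltW //=; lra.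
have [|y2 E2 N2] := ring1 s'; first by lra.
have I1 : complex.Re (f (a + cexp (s +i* y1)%C)) <= M.
  by apply: fM; rewrite addrC addKr N1.
have I2 : complex.Re (f a) - e <= complex.Re (f (a + cexp (s' +i* y2)%C)).
  have := H1 (a + cexp (s' +i* y2)%C); rewrite addrC addKr N2 => /(_ es').
  move=> /(le_lt_trans (Re_normc _)); rewrite cReD cReN addrC ltr_norml; lra.
move=> JE.
have E12 : complex.Re (f (a + cexp (s +i* y1)%C)) * (2 * pi) =
    complex.Re (f (a + cexp (s' +i* y2)%C)) * (2 * pi).
  by rewrite E1 E2; move: VE JE; clear; lra.
have E3 := mulIf (lt0r_neq0 pi2) E12.
by move: I2; rewrite -E3 lerBlDr => /le_trans; apply; rewrite lerD2r.
Qed.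

End CircleMean.

(** * The maximum principle with one exceptional point *)

Section MaxPrinciple.
Variable R : realType.
Local Notation C := (Cplx R).
Implicit Types (z w : C).

Lemma continuous_real_normcP (f : C -> R) z : {for z, continuous f} <->
  forall e : R, 0 < e -> exists2 r : R, 0 < r &
    forall w, normc (w - z) < r -> `|f w - f z| < e.
Proof.
have P := @cvgrPdist_lt _ _ _ (nbhs z) (nbhs_filter z) f (f z).
split=> [/P H e e0|H].
  have /nbhs_normcP[r r0 h] := H e e0; exists r => // w /h; by rewrite distrC.
apply/P => e e0; have [r r0 h] := H e e0; apply/nbhs_normcP; exists r => // w /h.
by rewrite distrC.
Qed.

Lemma normc_continuous : continuous (fun z : C => normc z).
Proof.
move=> z; apply/continuous_real_normcP => e e0; exists e => // w wz.
apply: le_lt_trans wz; rewrite ler_norml lerNl opprB normc_subr.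
by rewrite normc_dist normc_subr.
Qed.

Lemma dist_continuous (c : C) : continuous (fun z : C => normc (z - c)).
Proof.
move=> z; apply/continuous_real_normcP => e e0; exists e => // w wz.
apply: le_lt_trans wz; rewrite ler_norml lerNl opprB.
have h1 := normc_subr (z - c) (w - c); have h2 := normc_subr (w - c) (z - c).
have E x y : x - c - (y - c) = x - y by rewrite opprB addrA subrK.
by rewrite E (normc_dist z w) in h1; rewrite E in h2; rewrite h1 h2.
Qed.

(** The disc is closed in the image of a compact square. *)
Lemma compact_disc (c : C) (r : R) : compact [set z : C | normc (z - c) <= r].
Proof.
pose sq := `[complex.Re c - r, complex.Re c + r] `*` `[complex.Im c - r, complex.Im c + r].
have csq : compact ((fun x : R * R => (x.1 +i* x.2)%C : C) @` sq).
  apply: continuous_compact; last by apply: compact_setX; exact: segment_compact.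
  apply: continuous_subspaceT => x.
  apply/(@cvg_normcP _ _ (nbhs x)) => e e0.
  have e20 : 0 < e / 2 by rewrite divr_gt0.
  apply: filterS (nbhsx_ballx x _ e20) => y [y1 y2].
  have := normc_ReIm ((y.1 +i* y.2)%C - (x.1 +i* x.2)%C).
  move=> /le_lt_trans; apply => /=; rewrite [e]splitr ltrD // distrC.
    by move: y1; rewrite -ball_normE.
  by move: y2; rewrite -ball_normE.
apply: subclosed_compact csq _.
  apply: (@closed_comp _ _ (fun z : C => normc (z - c)) [set x | x <= r]).
    by move=> z _; exact: dist_continuous.
  exact: closed_le.
move=> z /= zc; exists (complex.Re z, complex.Im z); last by case: (z).
have := le_trans (Re_normc _) zc; have := le_trans (Im_normc _) zc.
by rewrite cReD cImD cReN cImN !ler_norml /sq /= !in_itv /=; lra.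
Qed.

Lemma cReZ (k : R) z : complex.Re ((k%:C)%C * z) = k * complex.Re z.
Proof. by rewrite cReM /= mul0r subr0. Qed.

Lemma sqr_normcD z w :
  normc (z + w) ^+ 2 = normc z ^+ 2 + normc w ^+ 2 + 2 * complex.Re ((z^*)%C * w).
Proof. rewrite !sqr_normcE cReM cReD cImD cReJ cImJ; ring. Qed.

(** A maximum point z0 of |q|^2 + eta |z - c|^2 over the closed disc is interior if
    eta is small. There the real part of the holomorphic function
    conj (q z0) q + eta conj (z0 - c) (z - z0) would exceed its values on
    small circles, by the strict convexity of the second summand, against
    [re_circle_max]. As in that lemma the centre may be a point where q is merely
    continuous. *)
Lemma max_principle (q : C -> C) (c : C) (rho R0 K : R) :
  (forall z, 0 < normc (z - c) < R0 -> derivable q z (1 : C)) ->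
  {for c, continuous q} -> 0 < rho -> rho < R0 ->
  (forall z, normc (z - c) = rho -> normc (q z) <= K) ->
  forall z, normc (z - c) <= rho -> normc (q z) <= K.
Proof.
move=> dq cq rho0 rhoR qK b bc; rewrite leNgt; apply/negP => Kb.
have K0 : 0 <= K.
  apply: le_trans (normc_ge0 _) (qK (c + (rho%:C)%C) _).
  by rewrite addrC addKr normcR gtr0_norm.
(* So small that eta |z - c|^2 cannot lift the values on the circle to |q b|^2. *)
pose eta : R := (normc (q b) ^+ 2 - K ^+ 2) / (2 * rho ^+ 2).
have rho2 : 0 < rho ^+ 2 by rewrite exprn_gt0.
have Kb2 : 0 < normc (q b) ^+ 2 - K ^+ 2 by rewrite subr_gt0 ltr_pXn2r // nnegrE normc_ge0.
have eta0 : 0 < eta by rewrite divr_gt0 // mulr_gt0.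
have etaE : K ^+ 2 + eta * rho ^+ 2 < normc (q b) ^+ 2.
  have -> : eta * rho ^+ 2 = (normc (q b) ^+ 2 - K ^+ 2) / 2.
    by rewrite /eta; field; rewrite lt0r_neq0.
  by move: Kb2; clear; lra.
pose h z : R := normc (q z) ^+ 2 + eta * normc (z - c) ^+ 2.
have cqz z : normc (z - c) <= rho -> {for z, continuous q}.
  move=> zc; have [->//|zc0] := eqVneq z c.
  apply: derivable_continuous; apply: dq.
  by rewrite normc_gt0 subr_eq0 zc0 (le_lt_trans zc).
have ch z : normc (z - c) <= rho -> {for z, continuous h}.
  move=> zc; apply: continuousD.
    apply: (@continuous_comp _ _ _ (fun w => normc (q w)) (fun x : R => x ^+ 2)).
      apply: continuous_comp; first exact: cqz.
      exact: normc_continuous.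
    exact: exprn_continuous.
  apply: continuousM; first exact: cst_continuous.
  apply: (@continuous_comp _ _ _ (fun z : C => normc (z - c)) (fun x : R => x ^+ 2)).
    exact: dist_continuous.
  exact: exprn_continuous.
have [|z0 z0c z0max] := @compact_EVT_max C R h _ (ex_intro _ b bc)
    (@compact_disc c rho) _.
  by apply: continuous_in_subspaceT => z /set_mem; exact: ch.
move: z0c => /set_mem /= z0c.
have hb : K ^+ 2 + eta * rho ^+ 2 < h z0.
  apply: lt_le_trans etaE _; apply: le_trans (z0max b (mem_set bc)).
  by rewrite /h lerDl mulr_ge0 ?exprn_ge0 ?normc_ge0 // ltW.
have {}z0c : normc (z0 - c) < rho.
  rewrite lt_neqAle z0c andbT; apply/eqP => E.
  move: hb; rewrite /h E ltrD2r ltNge => /negP; apply.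
  by rewrite ler_pXn2r ?nnegrE ?normc_ge0 ?qK.
(* The disc of radius r around z0 must avoid c, unless z0 = c, since q may not be
   differentiable there. *)
have [r r0 [rr rc]] : exists2 r : R, 0 < r & normc (z0 - c) + r <= rho /\ (z0 != c -> r <= normc (z0 - c)).
  have [E|z0c0] := eqVneq z0 c.
    exists rho => //; split=> //.
    by rewrite E subrr normc0 add0r.
  exists (Num.min (rho - normc (z0 - c)) (normc (z0 - c))).
    by rewrite lt_min subr_gt0 z0c normc_gt0 subr_eq0.
  split=> [|_]; last by rewrite ge_min lexx orbT.
  by rewrite -lerBrDl ge_min lexx.
pose Q z : C := ((q z0)^*)%C * q z + (eta%:C)%C * ((z0 - c)^*)%C * (z - z0).
have r20 : 0 < r / 2 by rewrite divr_gt0.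
have r2r : r / 2 < r by rewrite ltr_pdivrMr // mulr_natr mulr2n ltrDl.
have tri z : normc (z - c) <= normc (z0 - c) + normc (z - z0).
  have -> : z - c = (z0 - c) + (z - z0) by rewrite [RHS]addrC addrA subrK.
  exact: le_normcD.
have lin z : derivable (fun z => z - z0 : C) z (1 : C).
  by apply: derivableB; [exact: derivable_id|exact: derivable_cst].
have := @re_circle_max R Q z0 r (r / 2) (normc (q z0) ^+ 2 - eta * (r / 2) ^+ 2 / 2) _ _ r20 r2r _.
have QE : complex.Re (Q z0) = normc (q z0) ^+ 2.
  by rewrite /Q subrr mulr0 addr0 sqr_normcE cReM cReJ cImJ; ring.
rewrite QE => H.
suff : normc (q z0) ^+ 2 <= normc (q z0) ^+ 2 - eta * (r / 2) ^+ 2 / 2.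
  rewrite lerBrDl gerDr leNgt => /negP; apply.
  by rewrite divr_gt0 // mulr_gt0 // exprn_gt0.
apply: H.
- move=> z /andP[zz0 zr]; apply: derivableD.
    apply: derivableM; first exact: derivable_cst.
    apply: dq; apply/andP; split.
      rewrite normc_gt0 subr_eq0; apply/eqP => E.
      have z0c1 : z0 != c.
        by apply/eqP => E2; move: zz0; rewrite E E2 subrr normc0 ltxx.
      by have := rc z0c1; rewrite normc_dist -E leNgt zr.
    apply: le_lt_trans rhoR; apply: le_trans (tri z) (le_trans _ rr).
    by rewrite lerD2l ltW.
  by apply: derivableM; [exact: derivable_cst|exact: lin].
- apply: continuousD.
    by apply: continuousM; [exact: cst_continuous|exact/cqz/ltW].
  apply: continuousM; first exact: cst_continuous.
  exact: (derivable_continuous (lin z0)).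
- move=> z zr.
  have zd : normc (z - c) <= rho.
    by apply: le_trans (tri z) (le_trans _ rr); rewrite zr lerD2l ltW.
  have := z0max z (mem_set zd); rewrite /h.
  have -> : z - c = (z0 - c) + (z - z0) by rewrite [RHS]addrC addrA subrK.
  rewrite (sqr_normcD (z0 - c) (z - z0)) zr.
  have : 2 * complex.Re (((q z0)^*)%C * q z) <= normc (q z0) ^+ 2 + normc (q z) ^+ 2.
    have := sqr_ge0 (normc (q z0 + - q z)); rewrite sqr_normcD normcN mulrN cReN.
    by lra.
  rewrite /Q cReD -mulrA cReZ.
  nra.
Qed.

End MaxPrinciple.

(** * Schwarz and Schwarz-Pick lemmas *)

Section SchwarzPick.
Variable R : realType.
Local Notation C := (Cplx R).
Implicit Types (z w : C).

Lemma derivable_sub (c z : C) : derivable (fun z => z - c : C) z (1 : C).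
Proof. by apply: derivableB; [exact: derivable_id|exact: derivable_cst]. Qed.

Lemma derivable_subX (c z : C) n : derivable (fun z => (z - c) ^+ n : C) z (1 : C).
Proof.
apply: (@derivable_chain R (fun u : C => u ^+ n) (fun z => z - c)).
  exact: derivable_sub.
exact: (@exprn_derivable R[i] n (z - c) 1).
Qed.

(** The maximum principle for T z / (z - c), extended by T' c at c. *)
Lemma schwarz (T : C -> C) (c : C) (r : R) :
  (forall z, normc (z - c) < r -> derivable T z (1 : C)) ->
  (forall z, normc (z - c) < r -> normc (T z) <= 1) -> T c = 0 ->
  forall z, normc (z - c) < r -> r * normc (T z) <= normc (z - c).
Proof.
move=> dT T1 Tc z zr.
have r0 : 0 < r by apply: le_lt_trans zr; exact: normc_ge0.
have [->|Tz0] := eqVneq (T z) 0.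
  by rewrite normc0 mulr0 normc_ge0.
have zc : z != c by apply: contra_neq Tz0 => ->.
have Tz : 0 < normc (T z) by rewrite normc_gt0.
rewrite leNgt; apply/negP; rewrite -ltr_pdivrMr // => tr.
(* If the claim fails, T z / (z - c) exceeds 1 / rho for some rho between |z - c|
   and r. *)
have zt : normc (z - c) <= normc (z - c) / normc (T z).
  by rewrite ler_pdivlMr // ler_piMr ?normc_ge0 // T1.
set t := normc (z - c) / normc (T z) in tr zt.
pose rho := (t + r) / 2.
have trho : t < rho by rewrite /rho; lra.
have rhor : rho < r by rewrite /rho; lra.
have rho0 : 0 < rho by apply: le_lt_trans trho; apply: le_trans zt; exact: normc_ge0.
have [d Td] : exists d, cderiv_at T c d.
  by apply/derivable_cderiv; apply: dT; rewrite subrr normc0.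
pose q w := if w == c then d else T w * (w - c)^-1.
have dq w : 0 < normc (w - c) < r -> derivable q w (1 : C).
  move=> /andP[w0 wr].
  apply: (@cderiv_near _ _ (fun w => T w * (w - c)^-1) _ (normc (w - c))) => // [v vw|].
    rewrite /q; case: eqVneq => // vc; move: vw.
    by rewrite vc normc_dist ltxx.
  apply: derivableM; first exact: dT.
  apply: derivableV; last exact: derivable_sub.
  by rewrite -normc_gt0.
have cq : {for c, continuous q}.
  apply/continuous_normcP => e e0.
  have e20 : 0 < e / 2 by rewrite divr_gt0.
  have [s s0 H] := Td _ e20; exists s => // w ws.
  rewrite /q eqxx; case: eqVneq => [_|wc].
    by rewrite subrr normc0.
  have wc0 : w - c != 0 by rewrite subr_eq0.
  have wc1 : 0 < normc (w - c) by rewrite normc_gt0.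
  have := H w ws; rewrite Tc subr0.
  have -> : T w - d * (w - c) = (T w * (w - c)^-1 - d) * (w - c) by field.
  rewrite normcM ler_pM2r // => /le_lt_trans; apply.
  by rewrite ltr_pdivrMr // mulr_natr mulr2n ltrDl.
have := @max_principle R q c rho r (rho^-1) dq cq rho0 rhor _ z (ltW (le_lt_trans zt trho)).
rewrite /q (negbTE zc) => H.
have {}H : normc (T z * (z - c)^-1) <= rho^-1.
  apply: H => w wr; rewrite ifN; last first.
    by rewrite -subr_eq0 -normc_gt0 wr.
  by rewrite normcM normcV wr ler_piMl ?invr_ge0 ?(ltW rho0) // T1 // wr.
have zc0 : 0 < normc (z - c) by rewrite normc_gt0 subr_eq0.
move: H; rewrite normcM normcV ler_pdivrMr // [leRHS]mulrC ler_pdivlMr //.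
by rewrite [leLHS]mulrC -ler_pdivlMr // leNgt trho.
Qed.

Lemma normc_sub_lt_conj (a b : C) : 0 < complex.Re a -> 0 < complex.Re b ->
  normc (a - b) < normc (a + (b^*)%C).
Proof.
move=> a0 b0; rewrite -(@ltr_pXn2r _ 2) ?nnegrE ?normc_ge0 // !sqr_normcE.
rewrite !cReD !cImD cReN cImN cReJ cImJ ltrD2r -subr_gt0.
have -> : (complex.Re a + complex.Re b) ^+ 2 - (complex.Re a - complex.Re b) ^+ 2 =
  4 * (complex.Re a * complex.Re b) by ring.
by rewrite mulr_gt0 // mulr_gt0.
Qed.

Lemma add_conj_neq0 (a b : C) : 0 < complex.Re a -> 0 < complex.Re b ->
  a + (b^*)%C != 0.
Proof.
move=> a0 b0; apply/eqP => /(congr1 (@complex.Re R)).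
by rewrite cReD cReJ /= => E; have := addr_gt0 a0 b0; rewrite E ltxx.
Qed.

(** [schwarz] for the Cayley transform (g z - g c) / (g z + conj (g c)). *)
Lemma schwarz_pick_disc (g : C -> C) (c : C) (r : R) :
  (forall z, normc (z - c) < r -> derivable g z (1 : C)) ->
  (forall z, normc (z - c) < r -> 0 < complex.Re (g z)) ->
  forall z, normc (z - c) < r ->
  r * normc (g z - g c) <= normc (z - c) * normc (g z + ((g c)^*)%C).
Proof.
move=> dg g0 z zr.
have r0 : 0 < r by apply: le_lt_trans zr; exact: normc_ge0.
have gc0 : 0 < complex.Re (g c) by apply: g0; rewrite subrr normc0.
pose T w := (g w - g c) * (g w + ((g c)^*)%C)^-1.
have den w : normc (w - c) < r -> 0 < normc (g w + ((g c)^*)%C).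
  by move=> wr; rewrite normc_gt0 add_conj_neq0 // g0.
have := @schwarz T c r _ _ _ z zr.
rewrite /T normcM normcV mulrA ler_pdivrMr ?den //; apply.
- move=> w wr; apply: derivableM.
    by apply: derivableB; [exact: dg|exact: derivable_cst].
  apply: derivableV; first by rewrite -normc_gt0 den.
  by apply: derivableD; [exact: dg|exact: derivable_cst].
- move=> w wr; rewrite normcM normcV ler_pdivrMr ?den // mul1r.
  by apply/ltW/normc_sub_lt_conj => //; exact: g0.
- by rewrite subrr mul0r.
Qed.

Lemma cRe_div (z w : C) :
  complex.Re (z * w^-1) = complex.Re (z * (w^*)%C) / normc w ^+ 2.
Proof.
rewrite sqr_normcE !cReM cReJ cImJ; case: z => a b; case: w => c d /=.
by ring.
Qed.

(** [schwarz_pick_disc] on the unit disc, transported by the Moebius map psi that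
    sends the disc to the half-plane and 0 to x. Multiplying out the two
    denominators gives a form without side conditions. *)
Lemma schwarz_pick (g : C -> C) (A : R) :
  (forall z, A < complex.Re z -> derivable g z (1 : C)) ->
  (forall z, A < complex.Re z -> 0 < complex.Re (g z)) ->
  forall x w, A < complex.Re x -> A < complex.Re w ->
  normc (g w - g x) * normc (w + (x^*)%C - 2 * (A%:C)%C) <=
  normc (w - x) * normc (g w + ((g x)^*)%C).
Proof.
move=> dg g0 x w xA wA.
pose x' : C := x - (A%:C)%C.
have x'0 : 0 < complex.Re x' by rewrite /x' cReD cReN /= subr_gt0.
pose w' : C := w - (A%:C)%C.
have w'0 : 0 < complex.Re w' by rewrite /w' cReD cReN /= subr_gt0.
pose psi (xi : C) : C := (A%:C)%C + (x' + (x'^*)%C * xi) * (1 - xi)^-1.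
have den (xi : C) : normc (xi - 0) < 1 -> 1 - xi != 0.
  rewrite subr0 => xi1; apply: contraTneq xi1 => /eqP; rewrite subr_eq0 => /eqP <-.
  by rewrite normc1 ltxx.
have dpsi (xi : C) : normc (xi - 0) < 1 -> derivable psi xi (1 : C).
  move=> xi1; apply: derivableD; first exact: derivable_cst.
  apply: derivableM.
    apply: derivableD; first exact: derivable_cst.
    by apply: derivableM; [exact: derivable_cst|exact: derivable_id].
  apply: derivableV; first exact: den.
  by apply: derivableB; [exact: derivable_cst|exact: derivable_id].
have psiA (xi : C) : normc (xi - 0) < 1 -> A < complex.Re (psi xi).
  move=> xi1; have d0 := den _ xi1; rewrite subr0 in xi1.
  have n0 : 0 < normc (1 - xi) ^+ 2 by rewrite exprn_gt0 // normc_gt0.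
  rewrite cReD /= ltrDl.
  have xi2 : 0 < 1 - normc xi ^+ 2.
    by rewrite subr_gt0 expr_lt1 ?normc_ge0.
  have -> : complex.Re ((x' + (x'^*)%C * xi) * (1 - xi)^-1) =
    complex.Re x' * (1 - normc xi ^+ 2) / normc (1 - xi) ^+ 2.
    rewrite cRe_div; congr (_ / _).
    rewrite sqr_normcE !(cReM, cReD, cReN, cImM, cImD, cImN, cReJ, cImJ) /=.
    by ring.
  by rewrite divr_gt0 // mulr_gt0.
pose xi : C := (w' - x') * (w' + (x'^*)%C)^-1.
have wx0 : w' + (x'^*)%C != 0 by exact: add_conj_neq0.
have wxn : 0 < normc (w' + (x'^*)%C) by rewrite normc_gt0.
have xi1 : normc (xi - 0) < 1.
  rewrite subr0 /xi normcM normcV ltr_pdivrMr // mul1r.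
  exact: normc_sub_lt_conj.
have psi0 : psi 0 = x by rewrite /psi mulr0 addr0 subr0 invr1 mulr1 addrC subrK.
have psixi : psi xi = w.
  rewrite /psi /xi.
  have e1 : 1 - (w' - x') * (w' + (x'^*)%C)^-1 = (x' + (x'^*)%C) * (w' + (x'^*)%C)^-1.
    by field.
  have e2 : x' + (x'^*)%C * ((w' - x') * (w' + (x'^*)%C)^-1) =
     w' * ((x' + (x'^*)%C) * (w' + (x'^*)%C)^-1) by field.
  have e3 : (x' + (x'^*)%C) * (w' + (x'^*)%C)^-1 != 0.
    by apply: mulf_neq0; [exact: add_conj_neq0|rewrite invr_eq0].
  by rewrite e1 e2 (mulfK e3) /w' addrC subrK.
have := @schwarz_pick_disc (fun xi => g (psi xi)) 0 1 _ _ xi xi1.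
rewrite psi0 psixi subr0 mul1r => H.
have {}H : normc (g w - g x) <= normc xi * normc (g w + ((g x)^*)%C).
  apply: H => z z1; last by apply/g0/psiA.
  by apply: derivable_chain; [exact: dpsi|apply/dg/psiA].
have -> : w + (x^*)%C - 2 * (A%:C)%C = w' + (x'^*)%C.
  apply: complex_ext; rewrite /w' /x'; move: (x) (w) => [a b] [u v] /=; ring.
have -> : w - x = w' - x' by rewrite /w' /x' opprB addrA subrK.
rewrite -ler_pdivlMr //; apply: le_trans H _.
by rewrite /xi normcM normcV mulrAC.
Qed.

Lemma expr_to0 (K t d : R) : 0 <= t < 1 -> 0 < d -> exists n, K * t ^+ n < d.
Proof.
move=> /andP[t0 t1] d0.
have : (K * t ^+ n) @[n --> \oo] --> K * 0.
  by apply: cvgM; [exact: cvg_cst|apply: cvg_expr; rewrite ger0_norm].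
rewrite mulr0 => /cvgr_lt /(_ d d0) [N _ /(_ N)] /= H.
by exists N; apply: H.
Qed.

(** A holomorphic function that is 0 near c can be divided by any power of z - c,
    so the maximum principle gives |f z| <= K (|z - c| / rho)^n for all n. *)
Lemma vanish_disc (f : C -> C) (c : C) (r s K : R) :
  (forall z, normc (z - c) < r -> derivable f z (1 : C)) ->
  (forall z, normc (z - c) < r -> normc (f z) <= K) -> 0 < s ->
  (forall z, normc (z - c) < s -> f z = 0) ->
  forall z, normc (z - c) < r -> f z = 0.
Proof.
move=> df fK s0 fs z zr; apply/eqP; rewrite -normc_eq0 eq_le normc_ge0 andbT leNgt.
apply/negP => fz0.
have zc0 := normc_ge0 (z - c).
pose rho := (normc (z - c) + r) / 2.
have zrho : normc (z - c) < rho by rewrite /rho; lra.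
have rhor : rho < r by rewrite /rho; lra.
have rho0 : 0 < rho by exact: le_lt_trans zrho.
have [|n] := @expr_to0 K (normc (z - c) / rho) (normc (f z)) _ fz0.
  by rewrite divr_ge0 // ?ltW //= ltr_pdivrMr // mul1r.
rewrite ltNge => /negP; apply.
have [zs|sz] := ltP (normc (z - c)) s.
  by rewrite fs // normc0 ltxx in fz0.
have zc1 : 0 < normc (z - c) by exact: lt_le_trans sz.
pose q w := f w * ((w - c) ^+ n)^-1.
have qs w : normc (w - c) < s -> q w = 0 by move=> ws; rewrite /q fs // mul0r.
have cs : normc (c - c) < s by rewrite subrr normc0.
have normcX w k : normc (w ^+ k) = normc w ^+ k.
  elim: k => [|k IH]; first by rewrite !expr0 normc1.
  by rewrite !exprS normcM IH.
have := @max_principle R q c rho r (K / rho ^+ n) _ _ rho0 rhor _ z (ltW zrho).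
rewrite /q normcM normcV normcX ler_pdivrMr ?exprn_gt0 // => H.
have -> : K * (normc (z - c) / rho) ^+ n = K / rho ^+ n * normc (z - c) ^+ n.
  by rewrite expr_div_n mulrA mulrAC.
apply: H.
- move=> w /andP[w0 wr]; apply: derivableM; first exact: df.
  apply: derivableV; first by rewrite expf_neq0 // -normc_gt0.
  exact: derivable_subX.
- apply/continuous_normcP => e e0; exists s => // w ws.
  by rewrite !fs // !mul0r subrr normc0.
- move=> w wr; rewrite normcM normcV normcX wr.
  by rewrite ler_wpM2r ?invr_ge0 ?exprn_ge0 ?(ltW rho0) // fK // wr.
Qed.

End SchwarzPick.

(** * Consequences of the Schwarz-Pick lemma for half-planes *)

Section SchwarzPickForms.
Variable R : realType.
Local Notation C := (Cplx R).
Implicit Types (z w : C) (x : R).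

Lemma Re_le_normc z : complex.Re z <= normc z.
Proof. exact: le_trans (ler_norm _) (Re_normc z). Qed.

(** |a + conj b|^2 = |a - b|^2 + 4 Re a Re b turns [schwarz_pick] into a form whose
    two sides can be compared as x tends to infinity. *)
Lemma schwarz_pick_sqr (g : C -> C) (A : R) :
  (forall z, A < complex.Re z -> derivable g z (1 : C)) ->
  (forall z, A < complex.Re z -> 0 < complex.Re (g z)) ->
  forall x w : C, A < complex.Re x -> A < complex.Re w ->
  normc (g w - g x) ^+ 2 * ((complex.Re w - A) * (complex.Re x - A)) <=
  normc (w - x) ^+ 2 * (complex.Re (g w) * complex.Re (g x)).
Proof.
move=> dg g0 x w xA wA; have := schwarz_pick dg g0 xA wA.
rewrite -(@ler_pXn2r _ 2) ?nnegrE ?mulr_ge0 ?normc_ge0 // !exprMn.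
have E1 : normc (w + (x^*)%C - 2 * (A%:C)%C) ^+ 2 =
    normc (w - x) ^+ 2 + 4 * ((complex.Re w - A) * (complex.Re x - A)).
  rewrite !sqr_normcE; move: (w) (x) => [a b] [c d] /=; ring.
have E2 : normc (g w + ((g x)^*)%C) ^+ 2 =
    normc (g w - g x) ^+ 2 + 4 * (complex.Re (g w) * complex.Re (g x)).
  rewrite !sqr_normcE; move: (g w) (g x) => [a b] [c d] /=; ring.
rewrite E1 E2 (mulrDr (normc (g w - g x) ^+ 2)) (mulrDr (normc (w - x) ^+ 2)) [normc (w - x) ^+ 2 * normc (g w - g x) ^+ 2]mulrC lerD2l.
by rewrite !(mulrCA _ 4) ler_pM2l.
Qed.

(** Over a distance which is a fraction t of the distance from x to the edge of
    the half-plane, g oscillates by at most a multiple of t times Re (g x). *)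
Lemma schwarz_pick_osc (g : C -> C) (A t : R) (x w : C) :
  (forall z, A < complex.Re z -> derivable g z (1 : C)) ->
  (forall z, A < complex.Re z -> 0 < complex.Re (g z)) ->
  A < complex.Re x -> A < complex.Re w -> t <= 1 / 2 ->
  normc (w - x) <= t * (complex.Re x - A) ->
  normc (g w - g x) <= 4 * t * complex.Re (g x).
Proof.
move=> dg g0 xA wA t2 wxt.
have SP := schwarz_pick dg g0 xA wA.
have gx0 := g0 _ xA.
have xi0 : 0 < complex.Re x - A by rewrite subr_gt0.
have t0 : 0 <= t.
  by have := le_trans (normc_ge0 _) wxt; rewrite pmulr_lge0.
have d0 := normc_ge0 (g w - g x).
have h1 : complex.Re x - A <= normc (w + (x^*)%C - 2 * (A%:C)%C).
  apply: le_trans (Re_le_normc _).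
  by rewrite cReD cReN cReD cReJ cReM /=; lra.
have h2 : normc (g w + ((g x)^*)%C) <= normc (g w - g x) + 2 * complex.Re (g x).
  have -> : g w + ((g x)^*)%C = (g w - g x) + ((2 * complex.Re (g x))%:C)%C.
    by apply: complex_ext; move: (g w) (g x) => [a b] [c d] /=; ring.
  apply: le_trans (le_normcD _ _) _; rewrite lerD2l normcR ger0_norm //.
  by rewrite mulr_ge0 // ltW.
have h3 : normc (g w - g x) * (complex.Re x - A) <=
   t * (complex.Re x - A) * (normc (g w - g x) + 2 * complex.Re (g x)).
  apply: le_trans (_ : _ <= normc (g w - g x) * normc (w + (x^*)%C - 2 * (A%:C)%C)) _.
    by rewrite ler_wpM2l.
  by apply: le_trans SP _; rewrite ler_pM ?normc_ge0.
move: h3; rewrite mulrAC ler_pM2r // => h3.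
have : t * normc (g w - g x) <= 1 / 2 * normc (g w - g x) by rewrite ler_wpM2r.
by move: h3; lra.
Qed.

(** The points at distances x and 4x from the edge have pseudo-hyperbolic
    distance 3/5, and (1 + 3/5) / (1 - 3/5) = 4. *)
Lemma schwarz_pick_ray (g : C -> C) (A x : R) :
  (forall z, A < complex.Re z -> derivable g z (1 : C)) ->
  (forall z, A < complex.Re z -> 0 < complex.Re (g z)) -> 0 < x ->
  normc (g ((A + x)%:C)%C) <= 4 * normc (g ((A + 4 * x)%:C)%C) /\
  normc (g ((A + 4 * x)%:C)%C) <= 4 * normc (g ((A + x)%:C)%C).
Proof.
move=> dg g0 x0; set w := ((A + x)%:C)%C : C; set w' := ((A + 4 * x)%:C)%C : C.
have wA : A < complex.Re w by rewrite /= ltrDl.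
have wA' : A < complex.Re w' by rewrite /= ltrDl mulr_gt0.
have := schwarz_pick dg g0 wA wA'.
have -> : w' + (w^*)%C - 2 * (A%:C)%C = ((5 * x)%:C)%C.
  by apply: complex_ext => /=; ring.
have -> : w' - w = ((3 * x)%:C)%C by apply: complex_ext => /=; ring.
rewrite !normcR !gtr0_norm ?mulr_gt0 // mulrA [leRHS]mulrAC.
rewrite ler_pM2r // => SP.
have h := le_normcD (g w') ((g w)^*)%C; rewrite cnormJ in h.
have h1 := normc_subr (g w') (g w).
have h2 := normc_subr (g w) (g w'); rewrite normc_dist in h2.
by split; move: SP h h1 h2; lra.
Qed.

End SchwarzPickForms.

(** * Iteration of maps between half-planes *)

Section Dynamics.
Variable R : realType.
Local Notation C := (Cplx R).
Implicit Types (z w : C) (x : R).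

Variables (A : R) (Phi : nat -> C -> C).
Hypothesis A0 : 0 <= A.
Hypothesis dPhi : forall k z, A < complex.Re z -> derivable (Phi k) z (1 : C).
Hypothesis Phi_gt0 : forall k z, A < complex.Re z -> 0 < complex.Re (Phi k z).
Hypothesis Phi0 : forall z, A < complex.Re z -> Phi 0 z = z.
(** An orbit may leave the half-plane and come back, so Phi k is not the k-th
    iterate of Phi 1; orbits may be concatenated when the intermediate point lies in
    the half-plane. *)
Hypothesis PhiD : forall k l z, A < complex.Re z -> A < complex.Re (Phi k z) ->
  Phi (k + l) z = Phi l (Phi k z).
Hypothesis Phi_asym : forall k (e : R), 0 < e -> exists X : R, forall x, X < x ->
  normc (Phi k (x%:C)%C - (x%:C)%C) <= e * x.

(** Let x tend to infinity along the reals in [schwarz_pick_sqr]: after division by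
    x^3 the left side tends to Re z - A and the right side to Re (Phi k z). The
    constant e bounds all relative errors at once. *)
Lemma julia k z : A < complex.Re z -> complex.Re z - A <= complex.Re (Phi k z).
Proof.
move=> zA; have a0 : 0 < complex.Re z - A by rewrite subr_gt0.
have b0 := @Phi_gt0 k _ zA.
set a := complex.Re z - A in a0 *; set b := complex.Re (Phi k z) in b0 *.
rewrite leNgt; apply/negP => ba.
(* Chosen so that (1 - 5 e) a <= (1 + 7 e) b is impossible. *)
have [e [e0 e1 eE]] : exists e : R, [/\ 0 < e, e < 1 / 2 & e * (5 * a + 7 * b) < a - b].
  have ab : 0 < 5 * a + 7 * b by rewrite addr_gt0 // mulr_gt0.
  exists ((a - b) / (2 * (5 * a + 7 * b))); split.
  - by rewrite divr_gt0 ?subr_gt0 // mulr_gt0.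
  - by rewrite ltr_pdivrMr ?mulr_gt0 //; lra.
  - have -> : (a - b) / (2 * (5 * a + 7 * b)) * (5 * a + 7 * b) = (a - b) / 2.
      by field; rewrite lt0r_neq0.
    by move: ba; lra.
have [X HX] := Phi_asym k e0.
set N := normc z + normc (Phi k z) + A.
pose x := Num.max (X + 1) (N / e + 1).
have xX : X < x by rewrite lt_max ltrDl ltr01.
have xN : N < e * x.
  rewrite mulrC -ltr_pdivrMr // lt_max; apply/orP; right.
  by rewrite ltrDl ltr01.
have z0 := normc_ge0 z; have Pz0 := normc_ge0 (Phi k z).
have N0 : 0 <= N by rewrite /N addr_ge0 // addr_ge0.
have ex0 : 0 < e * x by exact: le_lt_trans xN.
have x0 : 0 < x by rewrite pmulr_rgt0 in ex0.
have xA : A < x.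
  have : e * x <= x by rewrite ler_piMl ?ltW //; lra.
  by move: xN z0 Pz0; rewrite /N; lra.
have := schwarz_pick_sqr (dPhi (k := k)) (@Phi_gt0 k) (x := (x%:C)%C) xA zA.
have {}HX := HX x xX.
have h1 : (1 - 2 * e) * x <= normc (Phi k z - Phi k (x%:C)%C).
  have n1 : normc ((x%:C)%C : C) = x by rewrite normcR gtr0_norm.
  have n2 := normc_subr (x%:C)%C (Phi k z - (Phi k (x%:C)%C - (x%:C)%C)).
  have n3 := normcB (Phi k z) (Phi k (x%:C)%C - (x%:C)%C).
  have E : (x%:C)%C - (Phi k z - (Phi k (x%:C)%C - (x%:C)%C)) = - (Phi k z - Phi k (x%:C)%C) by ring.
  rewrite E normcN n1 in n2.
  by move: n2 n3 HX xN z0; rewrite /N; move: A0; lra.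
have h2 : normc (z - (x%:C)%C) <= (1 + e) * x.
  have n1 := normcB z (x%:C)%C; rewrite normcR gtr0_norm // in n1.
  by move: n1 xN Pz0; rewrite /N; move: A0; lra.
have h3 : complex.Re (Phi k (x%:C)%C) <= (1 + e) * x.
  have := le_trans (Re_le_normc _) HX; rewrite cReD cReN /=.
  by lra.
have h4 : (1 - e) * x <= x - A.
  by move: xN z0 Pz0; rewrite /N; lra.
have h5 := @Phi_gt0 k (x%:C)%C xA.
rewrite -/a -/b /= => SP.
have e2 : 0 < 1 - 2 * e by move: e1; lra.
have e3 : 0 < 1 - e by move: e1 e0; lra.
have L : ((1 - 2 * e) * x) ^+ 2 * (a * ((1 - e) * x)) <=
         ((1 + e) * x) ^+ 2 * (b * ((1 + e) * x)).
  apply: le_trans (le_trans SP _).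
    apply: ler_pM.
    - by rewrite exprn_ge0 // mulr_ge0 ?ltW.
    - by rewrite !mulr_ge0 ?ltW.
    - by rewrite ler_pXn2r // nnegrE ?normc_ge0 // mulr_ge0 ?ltW.
    - by rewrite ler_pM2l.
  have u : 0 <= (1 + e) * x by rewrite mulr_ge0 ?ltW // addr_gt0.
  apply: ler_pM.
  - by rewrite exprn_ge0 // normc_ge0.
  - by rewrite mulr_ge0 ?ltW.
  - by rewrite ler_pXn2r // nnegrE ?normc_ge0.
  - by rewrite ler_pM2l.
have {}L : (1 - 2 * e) ^+ 2 * (1 - e) * a <= (1 + e) ^+ 3 * b.
  have x3 : 0 < x ^+ 3 by rewrite exprn_gt0.
  rewrite -(ler_pM2r x3); move: L; congr (_ <= _); ring.
have k1 : (1 - 5 * e) * a <= (1 - 2 * e) ^+ 2 * (1 - e) * a.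
  rewrite ler_pM2r // -subr_ge0.
  have -> : (1 - 2 * e) ^+ 2 * (1 - e) - (1 - 5 * e) = 4 * e ^+ 2 * (2 - e) by ring.
  by rewrite !mulr_ge0 ?exprn_ge0 ?ltW //; move: e1; lra.
have k2 : (1 + e) ^+ 3 * b <= (1 + 7 * e) * b.
  rewrite ler_pM2r // -subr_ge0.
  have -> : (1 + 7 * e) - (1 + e) ^+ 3 = e * (1 - e) * (4 + e) by ring.
  by rewrite mulr_ge0 ?mulr_ge0 ?(ltW e0) ?(ltW e3) // addr_ge0 ?(ltW e0).
by move: (le_trans k1 (le_trans L k2)) eE; lra.
Qed.

(** The first step of the orbit of z. *)
Let a0 z : C := Phi 1 z - z.
(** The shift is A + 1, not A, to make the real part strictly positive. *)
Let Q k z : C := Phi k z - z + ((A + 1)%:C)%C.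

Let A1 : 0 < A + 1. Proof. by rewrite ltr_pwDr. Qed.

Let derivable_Q k z : A < complex.Re z -> derivable (Q k) z (1 : C).
Proof.
move=> zA; apply: derivableD; last exact: derivable_cst.
by apply: derivableB; [exact: dPhi|exact: derivable_id].
Qed.

Let Re_Q k z : complex.Re (Q k z) = complex.Re (Phi k z) - complex.Re z + (A + 1).
Proof. by rewrite /Q !cReD cReN. Qed.

Let Q_gt0 k z : A < complex.Re z -> 0 < complex.Re (Q k z).
Proof. by move=> zA; rewrite Re_Q; have := julia k zA; lra. Qed.

Let Q_normc k z : normc (Q k z) <= normc (Phi k z - z) + (A + 1).
Proof. by apply: le_trans (le_normcD _ _) _; rewrite normcR gtr0_norm. Qed.

Let normc_Q k z : normc (Phi k z - z) <= normc (Q k z) + (A + 1).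
Proof.
have -> : Phi k z - z = Q k z - ((A + 1)%:C)%C by rewrite /Q addrK.
by apply: le_trans (normcB _ _) _; rewrite normcR gtr0_norm.
Qed.

Let Phi1_gtA z : A < complex.Re z -> normc (a0 z) <= 1 / 2 * (complex.Re z - A) ->
  A < complex.Re (Phi 1 z).
Proof.
move=> zA h.
have := le_trans (Re_normc (a0 z)) h; rewrite /a0 cReD cReN ler_norml; lra.
Qed.

(** Phi k.+1 z - Phi k z - a0 z = Q k (Phi 1 z) - Q k z, and Phi 1 z is close to z. *)
Lemma displacement_drift k z : A < complex.Re z ->
  normc (a0 z) <= 1 / 2 * (complex.Re z - A) ->
  normc (Phi k.+1 z - Phi k z - a0 z) <=
  4 * (normc (a0 z) / (complex.Re z - A)) * complex.Re (Q k z).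
Proof.
move=> zA h; have zA1 := Phi1_gtA zA h.
have d0 : 0 < complex.Re z - A by rewrite subr_gt0.
have := @schwarz_pick_osc R (Q k) A (normc (a0 z) / (complex.Re z - A)) z (Phi 1 z)
  (@derivable_Q k) (@Q_gt0 k) zA zA1.
rewrite ler_pdivrMr // => /(_ h); rewrite -/(a0 z) divfK ?lt0r_neq0 // => /(_ (lexx _)).
by rewrite /Q -(@PhiD 1 k z zA zA1) add1n /a0; congr (normc _ <= _); ring.
Qed.

Lemma displacement_linear (e : R) n z : A < complex.Re z ->
  normc (a0 z) <= 1 / 2 * (complex.Re z - A) ->
  (forall k, (k < n)%N -> 4 * complex.Re (Q k z) <= e * (complex.Re z - A)) ->
  normc (Phi n z - z - n%:R * a0 z) <= n%:R * e * normc (a0 z).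
Proof.
move=> zA h He.
have d0 : 0 < complex.Re z - A by rewrite subr_gt0.
elim: n He => [|n IH] He.
  by rewrite Phi0 // subrr !mul0r subr0 normc0.
have -> : Phi n.+1 z - z - n.+1%:R * a0 z =
  (Phi n z - z - n%:R * a0 z) + (Phi n.+1 z - Phi n z - a0 z).
  by rewrite -natr1; ring.
apply: le_trans (le_normcD _ _) _; rewrite -natr1 !mulrDl mul1r lerD //.
  by apply: IH => k kn; apply: He; exact: ltnW.
apply: le_trans (displacement_drift n zA h) _.
have -> : e * normc (a0 z) = normc (a0 z) / (complex.Re z - A) * (e * (complex.Re z - A)).
  by field; rewrite lt0r_neq0.
rewrite mulrAC mulrC ler_wpM2l ?He // divr_ge0 ?normc_ge0 //; exact: ltW.
Qed.

(** If Re (Q k z) stays below an eighth of the distance to the edge, then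
    |Phi k z - z| >= k |a0 z| / 2 for all k, which is incompatible with
    a bounded subsequence unless a0 z = 0. *)
Lemma slow_orbit_fixed z : A < complex.Re z ->
  normc (a0 z) <= 1 / 2 * (complex.Re z - A) ->
  (forall k, 8 * complex.Re (Q k z) <= complex.Re z - A) ->
  (exists M : R, forall N, exists2 k, (N <= k)%N & normc (Phi k z - z) <= M) ->
  Phi 1 z = z.
Proof.
move=> zA h HQ [M HM]; apply/eqP; rewrite -subr_eq0 -normc_eq0 eq_le normc_ge0 andbT.
rewrite leNgt -/(a0 z); apply/negP => a00.
(* A number of steps after which the orbit has moved by more than M. *)
pose N := (Num.truncn (2 * M / normc (a0 z))).+1.
have [k Nk kM] := HM N.
have L : normc (Phi k z - z - k%:R * a0 z) <= k%:R * (1 / 2) * normc (a0 z).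
  by apply: displacement_linear => // j _; have := HQ j; lra.
have n1 := normc_subr (k%:R * a0 z) (k%:R * a0 z - (Phi k z - z)).
rewrite subKr normcM normc_nat [X in _ - X <= _]normc_dist in n1.
have : 2 * M < k%:R * normc (a0 z).
  rewrite -ltr_pdivrMr //; apply: lt_le_trans (truncnS_gt _) _.
  by rewrite ler_nat.
by lra.
Qed.

(** By [julia] the real parts along an orbit almost increase, so a bounded
    subsequence bounds them all. At a point y where they come within 1 of their
    supremum, Re (Q k y) <= A + 2 for every k and [slow_orbit_fixed] applies. The
    iterates of a point y' near the fixed point y stay near y by Schwarz-Pick,
    so [slow_orbit_fixed] applies to y' as well. *)
Lemma bounded_orbit_fixed : exists X : R, forall x, X < x ->
  (exists M : R, forall N, exists2 k, (N <= k)%N & normc (Phi k (x%:C)%C) <= M) ->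
  exists y r, [/\ 0 < r, (forall y', normc (y' - y) < r -> A < complex.Re y') &
     forall y', normc (y' - y) < r -> Phi 1 y' = y'].
Proof.
have e0 : 0 < 1 / 32 :> R by rewrite divr_gt0.
have [X0 HX0] := Phi_asym 1%N e0.
exists (Num.max X0 (100 * (A + 1))) => x.
rewrite gt_max => /andP[xX0 xA] [M HM].
set z : C := (x%:C)%C.
have zA : A < complex.Re z by rewrite /=; move: A0; lra.
have h0 : normc (a0 z) <= 1 / 16 * (complex.Re z - A).
  by have := HX0 x xX0; rewrite -/z -/(a0 z) /=; move: A0; lra.
have lo k := julia k zA; rewrite /= in lo.
have gA k : A < complex.Re (Phi k z) by have := lo k; move: A0; lra.
have Pz k l : Phi (k + l) z = Phi l (Phi k z) by apply: PhiD.
pose U := [set complex.Re (Phi k z) | k in setT].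
have Uub : ubound U (M + A).
  move=> _ [k _ <-]; have [k' kk' k'M] := HM k.
  have := julia (k' - k)%N (gA k); rewrite -Pz subnKC // => j.
  by have := le_trans (Re_le_normc _) k'M; lra.
have U0 : U !=set0 by exists (complex.Re (Phi 0%N z)), 0%N.
have hU : has_ubound U by exists (M + A).
(* From time K on, the real part cannot grow by more than 1. *)
have [_ [K _ <-] SK] := @sup_adherent R U 1 ltr01 (conj U0 hU).
set y := Phi K z in SK *.
have yA : A < complex.Re y by exact: gA.
have ylo : x - A <= complex.Re y by exact: lo.
have Qy k : complex.Re (Q k y) <= A + 2.
  rewrite Re_Q -Pz.
  have : complex.Re (Phi (K + k) z) <= sup U by apply: ub_le_sup => //; exists (K + k)%N.
  by move: SK; lra.
have a0y : normc (a0 y) <= 1 / 2 * (complex.Re y - A).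
  have zA1 : A < complex.Re (Phi 1 z) by exact: gA.
  have := @schwarz_pick_osc R (Phi K) A (1 / 16) z (Phi 1 z) (@dPhi K) (@Phi_gt0 K) zA zA1.
  move=> /(_ ltac:(lra) h0).
  rewrite -(@PhiD 1 K z zA zA1) addnC (@PhiD K 1 z zA (gA K)) -/y -/(a0 y).
  by move: ylo xA A0; lra.
have fy : Phi 1 y = y.
  apply: slow_orbit_fixed => // [k|].
    by have := Qy k; move: ylo xA A0; lra.
  exists (M + normc y) => N; have [k Nk kM] := HM (K + N)%N.
  exists (k - K)%N; first by rewrite leq_subRL // (leq_trans _ Nk) // leq_addr.
  rewrite -Pz subnKC; last by rewrite (leq_trans _ Nk) // leq_addr.
  by apply: le_trans (normcB _ _) _; rewrite lerD2r.
have fyk k : Phi k y = y.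
  elim: k => [|k IH]; first by rewrite Phi0.
  by rewrite -addn1 PhiD ?IH.
have d0 : 0 < complex.Re y - A by rewrite subr_gt0.
(* In this disc Re y' - A exceeds half of Re y - A, which is large. *)
have near_gtA y' : normc (y' - y) < 1 / 16 * (complex.Re y - A) ->
    A + (complex.Re y - A) / 2 < complex.Re y'.
  move=> /(le_lt_trans (Re_normc _)); rewrite cReD cReN ltr_norml; lra.
have near_gtA' y' : normc (y' - y) < 1 / 16 * (complex.Re y - A) -> A < complex.Re y'.
  by move=> /near_gtA; lra.
exists y, (1 / 16 * (complex.Re y - A)); split=> // [|y' y'y].
  by rewrite mulr_gt0 // divr_gt0.
have y'A := near_gtA' _ y'y; have y'A2 := near_gtA _ y'y.
have Qdist k : normc (Q k y' - Q k y) <= 1 / 4 * (A + 1).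
  have := @schwarz_pick_osc R (Q k) A (1 / 16) y y' (@derivable_Q k) (@Q_gt0 k) yA y'A.
  move=> /(_ ltac:(lra) (ltW y'y)); rewrite Re_Q fyk; lra.
have Qyk k : Q k y = ((A + 1)%:C)%C by rewrite /Q fyk subrr add0r.
have Phidist k : normc (Phi k y' - y') <= 1 / 4 * (A + 1).
  by have := Qdist k; rewrite Qyk /Q addrK.
apply: slow_orbit_fixed => // [|k|].
- have := Phidist 1%N; rewrite -/(a0 y'); move: y'A2 ylo xA A0; lra.
- have := le_trans (Re_le_normc _) (Phidist k).
  by rewrite cReD cReN Re_Q; move: y'A2 ylo xA A0; lra.
- by exists (1 / 4 * (A + 1)) => N; exists N.
Qed.

(** Here eta = 1 / (64 p) is the fraction of x which the orbit of w has to travel,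
    and e bounds the relative variation of speed of both orbits in the meantime.
    The additive constants of Q cost another relative error s. The hypothesis
    relating x and p makes 2 e + s at most 1 / (4 p). *)
Lemma displacement_ratio (x p : R) : 0 < x -> 1 <= p -> 64 * (64 * ((A + 1) * p ^+ 2)) <= x ->
  let w := ((A + x)%:C)%C in let w' := ((A + 4 * x)%:C)%C in
  normc (a0 w) <= 1 / 2 * x -> normc (a0 w') <= 1 / 2 * (4 * x) ->
  (exists n, x / (64 * p) <= normc (Phi n w - w)) ->
  (1 - 1 / (4 * p)) * normc (a0 w) <= 4 * normc (a0 w').
Proof.
move=> x0 p1 xp w w' h h' exn.
have p0 : 0 < p by exact: lt_le_trans p1.
pose eta : R := 1 / (64 * p).
have eta0 : 0 < eta by rewrite divr_gt0 // mulr_gt0.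
have px : x / (64 * p) = eta * x by rewrite /eta; ring.
have wA : A < complex.Re w by rewrite /= ltrDl.
have wA' : A < complex.Re w' by rewrite /= ltrDl mulr_gt0.
have wE : complex.Re w - A = x by rewrite /= addrC addKr.
have wE' : complex.Re w' - A = 4 * x by rewrite /= addrC addKr.
(* Up to time n both orbits stay in the regime of almost constant speed. *)
case: (ex_minnP exn) => n nx nmin.
have small k : (k < n)%N -> normc (Phi k w - w) <= eta * x.
  move=> kn; rewrite leNgt; apply/negP => kx.
  by have := nmin k; rewrite px ltW // => /(_ isT); rewrite leqNgt kn.
have n0 : (0 < n)%N.
  rewrite lt0n; apply/eqP => E; move: nx; rewrite E Phi0 // subrr normc0.
  by rewrite leNgt px mulr_gt0.
pose e : R := 4 * (eta + (A + 1) / x).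
have eE : e * x = 4 * (eta * x + (A + 1)) by rewrite /e; field; rewrite lt0r_neq0.
have e0 : 0 < e by rewrite mulr_gt0 // addr_gt0 // divr_gt0.
have L : normc (Phi n w - w - n%:R * a0 w) <= n%:R * e * normc (a0 w).
  apply: displacement_linear; rewrite ?wE // => k kn.
  rewrite eE ler_pM2l //; apply: le_trans (Re_le_normc _) _.
  by apply: le_trans (Q_normc k w) _; rewrite lerD2r small.
have L' : normc (Phi n w' - w' - n%:R * a0 w') <= n%:R * e * normc (a0 w').
  apply: displacement_linear; rewrite ?wE' // => k kn.
  rewrite mulrCA eE ler_pM2l //; apply: le_trans (Re_le_normc _) _.
  have [_ q] := @schwarz_pick_ray R (Q k) A x (@derivable_Q k) (@Q_gt0 k) x0.
  apply: le_trans q _; rewrite ler_pM2l //.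
  by apply: le_trans (Q_normc k w) _; rewrite lerD2r small.
have [q _] := @schwarz_pick_ray R (Q n) A x (@derivable_Q n) (@Q_gt0 n) x0.
have q1 := normc_Q n w; have q2 := Q_normc n w'.
rewrite -/w -/w' in q.
rewrite px in nx.
have nR : 0 < n%:R :> R by rewrite ltr0n.
have u1 : n%:R * normc (a0 w) * (1 - e) <= normc (Phi n w - w).
  have := normc_subr (n%:R * a0 w) (n%:R * a0 w - (Phi n w - w)).
  by rewrite subKr normcM normc_nat [X in _ - X <= _]normc_dist; move: L; lra.
have u2 : normc (Phi n w' - w') <= n%:R * normc (a0 w') * (1 + e).
  have := le_normcD (Phi n w' - w' - n%:R * a0 w') (n%:R * a0 w').
  by rewrite subrK normcM normc_nat; move: L'; lra.
pose s : R := 5 * (A + 1) / (eta * x).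
have sE : 5 * (A + 1) = s * (eta * x) by rewrite /s divfK // lt0r_neq0 // mulr_gt0.
have s0 : 0 < s by rewrite divr_gt0 // mulr_gt0.
have total : 2 * e + s <= 1 / (4 * p).
  have Ap : p * ((A + 1) / x) <= p^-1 / 64 / 64.
    have -> : p * ((A + 1) / x) = 64 * (64 * ((A + 1) * p ^+ 2)) / x * (p^-1 / 64 / 64).
      by field; rewrite !lt0r_neq0.
    have u : 0 <= p^-1 / 64 / 64 by rewrite !divr_ge0 // invr_ge0 ltW.
    have v : 64 * (64 * ((A + 1) * p ^+ 2)) / x <= 1 by rewrite ler_pdivrMr // mul1r.
    exact: ler_piMl u v.
  have Ax0 : 0 <= (A + 1) / x by rewrite divr_ge0 // ltW.
  have Ax : (A + 1) / x <= p * ((A + 1) / x) by rewrite ler_peMl.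
  have sx : s = 5 * (64 * (p * ((A + 1) / x))).
    by rewrite /s /eta; field; rewrite !lt0r_neq0.
  have etap : eta = p^-1 / 64 by rewrite /eta; field; rewrite lt0r_neq0.
  have -> : 1 / (4 * p) = p^-1 / 4 by field; rewrite lt0r_neq0.
  rewrite sx /e etap; lra.
have u3 : normc (Phi n w - w) * (1 - s) <= 4 * normc (Phi n w' - w').
  have : s * (eta * x) <= s * normc (Phi n w - w) by rewrite ler_pM2l.
  by move: q q1 q2 sE; lra.
have t1 : 1 / (4 * p) <= 1 / 4 by rewrite ler_pdivrMr ?mulr_gt0 //; lra.
have s1 : 0 <= 1 - s by move: total t1 e0; lra.
have u4 : n%:R * normc (a0 w) * (1 - e) * (1 - s) <= 4 * (n%:R * normc (a0 w') * (1 + e)).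
  apply: le_trans (ler_wpM2r s1 u1) _; apply: le_trans u3 _.
  by rewrite ler_pM2l.
have {}u4 : (1 - e) * (1 - s) * normc (a0 w) <= (1 + e) * (4 * normc (a0 w')).
  rewrite -(ler_pM2l nR); move: u4; congr (_ <= _); ring.
have a00 := normc_ge0 (a0 w).
have e1 : 0 < 1 + e by rewrite addr_gt0.
rewrite -(ler_pM2l e1); apply: le_trans u4.
rewrite mulrA ler_wpM2r // -subr_ge0.
have -> : (1 - e) * (1 - s) - (1 + e) * (1 - 1 / (4 * p)) =
  (1 / (4 * p) - (2 * e + s)) * (1 + e) + 2 * e * (e + s) by ring.
apply: addr_ge0; apply: mulr_ge0.
- by rewrite subr_ge0.
- exact: ltW.
- by rewrite mulr_ge0 // ltW.
- by rewrite addr_ge0 // ltW.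
Qed.

(** Apply [displacement_ratio] with p = 2^j and x = 4^j x0. The product of
    the factors 1 - 2^-j / 4 is bounded below, which the induction expresses
    through the explicit lower bound (1 + 2^-j) / 2. *)
Lemma displacement_lower_bound :
  (exists X : R, forall x, X < x -> forall M : R, exists k, M < normc (Phi k (x%:C)%C)) ->
  exists2 c : R, 0 < c & forall X : R, exists2 x, X < x &
    c <= x * normc (Phi 1 (x%:C)%C - (x%:C)%C).
Proof.
move=> [X0 esc].
have e0 : 0 < 1 / 4 :> R by rewrite divr_gt0.
have [X1 HX1] := Phi_asym 1%N e0.
pose x0 : R := Num.max (Num.max X0 X1) (64 * (64 * (A + 1))) + 1.
pose W p : C := ((A + p ^+ 2 * x0)%:C)%C.
have x0A : 64 * (64 * (A + 1)) <= x0 by rewrite /x0 -[leLHS]addr0 lerD // le_max lexx orbT.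
have X0x0 : X0 < x0 by rewrite /x0 ltr_pwDr // !le_max lexx.
have X1x0 : X1 < x0 by rewrite /x0 ltr_pwDr // !le_max lexx orbT.
have Ax0 : A <= x0 by move: x0A A0; lra.
have x00 : 0 < x0 by move: x0A A0; lra.
have x0p p : 1 <= p -> x0 <= p ^+ 2 * x0.
  by move=> p1; rewrite ler_peMl ?exprn_ege1 // ltW.
have X0W p : 1 <= p -> X0 < A + p ^+ 2 * x0.
  by move=> /x0p h; move: h X0x0 A0; lra.
have X1W p : 1 <= p -> X1 < A + p ^+ 2 * x0.
  by move=> /x0p h; move: h X1x0 A0; lra.
have WA p : 1 <= p -> A < complex.Re (W p).
  by move=> /x0p h; rewrite /=; move: h x00 A0; lra.
have a0W p : 1 <= p -> normc (a0 (W p)) <= 1 / 2 * (p ^+ 2 * x0).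
  move=> p1; have := HX1 _ (X1W _ p1); rewrite -/(W p) -/(a0 (W p)).
  by have := x0p _ p1; move: Ax0; lra.
have step p : 1 <= p -> (1 - 1 / (4 * p)) * normc (a0 (W p)) <= 4 * normc (a0 (W (2 * p))).
  move=> p1.
  have p2 : 1 <= 2 * p by move: p1; lra.
  have W2 : A + (2 * p) ^+ 2 * x0 = A + 4 * (p ^+ 2 * x0) by ring.
  have xx : 0 < p ^+ 2 * x0 by apply: lt_le_trans (x0p _ p1).
  have := @displacement_ratio (p ^+ 2 * x0) p xx p1.
  rewrite /= -W2 -/(W p) -/(W (2 * p)); apply.
  - have -> : 64 * (64 * ((A + 1) * p ^+ 2)) = p ^+ 2 * (64 * (64 * (A + 1))) by ring.
    by rewrite ler_wpM2l // exprn_ge0 //; move: p1; lra.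
  - exact: a0W.
  - have -> : 4 * (p ^+ 2 * x0) = (2 * p) ^+ 2 * x0 by ring.
    exact: a0W.
  - have [n nM] := esc _ (X0W _ p1) (p ^+ 2 * x0 / (64 * p) + normc (W p)).
    exists n; have := normc_subr (Phi n (W p)) (W p).
    by move: nM; rewrite -/(W p); lra.
have m0 : 0 < normc (a0 (W 1)).
  rewrite normc_gt0 subr_eq0; apply/eqP => fW.
  have fk k : Phi k (W 1) = W 1.
    elim: k => [|k IH]; first by rewrite Phi0 // WA.
    by rewrite -addn1 PhiD ?IH // WA.
  have [n] := esc _ (X0W _ (lexx 1)) (normc (W 1)).
  by rewrite -/(W 1) fk ltxx.
have key j : (1 + (2 ^+ j)^-1) / 2 * normc (a0 (W 1)) <= (2 ^+ j) ^+ 2 * normc (a0 (W (2 ^+ j))).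
  elim: j => [|j IH]; first by rewrite expr0 invr1 expr1n mul1r ler_piMl ?normc_ge0 //; lra.
  set p : R := 2 ^+ j in IH *.
  have p1 : 1 <= p by rewrite exprn_ege1 // ler1n.
  have p0 : 0 < p by exact: lt_le_trans p1.
  have i0 : 0 < p^-1 by rewrite invr_gt0.
  have i1 : p^-1 <= 1 by rewrite invf_le1.
  have t0 : 0 <= 1 - p^-1 / 4 by move: i1; lra.
  rewrite exprS -/p.
  have -> : (2 * p) ^+ 2 * normc (a0 (W (2 * p))) = p ^+ 2 * (4 * normc (a0 (W (2 * p)))) by ring.
  apply: le_trans (_ : _ <= p ^+ 2 * ((1 - 1 / (4 * p)) * normc (a0 (W p)))) _; last first.
    by rewrite ler_wpM2l ?exprn_ge0 ?step // ltW.
  have -> : p ^+ 2 * ((1 - 1 / (4 * p)) * normc (a0 (W p))) =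
      (1 - p^-1 / 4) * (p ^+ 2 * normc (a0 (W p))).
    by field; rewrite lt0r_neq0.
  apply: le_trans (ler_wpM2l t0 IH).
  rewrite mulrA ler_pM2r // invfM.
  have : 0 <= p^-1 * (1 - p^-1) by rewrite mulr_ge0 ?subr_ge0 // ltW.
  move: (p^-1) => i; lra.
exists (x0 * (1 / 2 * normc (a0 (W 1)))) => [|X].
  by rewrite mulr_gt0 // mulr_gt0 // divr_gt0.
have [j jX] : exists j : nat, X < 2 ^+ j.
  exists (Num.truncn X).+1; apply: lt_le_trans (truncnS_gt _) _.
  by rewrite -natrX ler_nat ltnW // ltn_expl.
have p1 : 1 <= 2 ^+ j :> R by rewrite exprn_ege1 // ler1n.
have p0 : 0 < 2 ^+ j :> R by exact: lt_le_trans p1.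
have i0 : 0 < (2 ^+ j)^-1 :> R by rewrite invr_gt0.
exists (A + (2 ^+ j) ^+ 2 * x0).
  have : 2 ^+ j <= (2 ^+ j) ^+ 2 * x0.
    rewrite expr2 -mulrA ler_peMr ?(ltW p0) //.
    have : x0 <= 2 ^+ j * x0 by rewrite ler_peMl ?(ltW x00).
    by move: x0A A0; lra.
  by move: jX A0; lra.
rewrite -/(W _) -/(a0 _).
have b0 := normc_ge0 (a0 (W (2 ^+ j))).
apply: le_trans (_ : _ <= (2 ^+ j) ^+ 2 * x0 * normc (a0 (W (2 ^+ j)))) _; last first.
  by rewrite ler_wpM2r // lerDr.
rewrite [leLHS]mulrC [leRHS]mulrAC ler_pM2r //; apply: le_trans (key j).
by rewrite ler_pM2r //; move: i0; lra.
Qed.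
End Dynamics.

(** * Taylor expansion of a defining function *)

Section Boundary.
Variable R : realType.
Local Notation C := (Cplx R).

(** A directional derivative along a coordinate axis is an ordinary derivative of
    the restriction to a line. *)
Lemma is_derive_fst (g : R * R -> R) (t y : R) : derivable g (t, y) ((1, 0) : R * R) ->
  is_derive t (1 : R) (fun s => g (s, y)) ('D_((1, 0) : R * R) g (t, y)).
Proof.
move=> dg.
have E : (fun h : R => h^-1 *: (((fun s => g (s, y)) \o shift t) (h *: (1 : R)) - g (t, y))) =
         (fun h : R => h^-1 *: ((g \o shift (t, y)) (h *: ((1, 0) : R * R)) - g (t, y))).
  apply/funext => h /=; congr (_ *: (g _ - _)).
  by apply: congr2; rewrite /= ?scaler0 ?add0r.
by apply: DeriveDef; rewrite /derivable /derive E.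
Qed.

Lemma is_derive_snd (g : R * R -> R) (x t : R) : derivable g (x, t) ((0, 1) : R * R) ->
  is_derive t (1 : R) (fun s => g (x, s)) ('D_((0, 1) : R * R) g (x, t)).
Proof.
move=> dg.
have E : (fun h : R => h^-1 *: (((fun s => g (x, s)) \o shift t) (h *: (1 : R)) - g (x, t))) =
         (fun h : R => h^-1 *: ((g \o shift (x, t)) (h *: ((0, 1) : R * R)) - g (x, t))).
  apply/funext => h /=; congr (_ *: (g _ - _)).
  by apply: congr2; rewrite /= ?scaler0 ?add0r.
by apply: DeriveDef; rewrite /derivable /derive E.
Qed.

Lemma mvt_signed (P f : R -> R) (x0 d t : R) :
  (forall x, `|x - x0| < d -> is_derive x (1 : R) P (f x)) -> `|t| < d ->
  exists2 s, `|s| <= `|t| & P (x0 + t) - P x0 = f (x0 + s) * t.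
Proof.
move=> dP td.
have dP' x : x0 - d < x < x0 + d -> is_derive x (1 : R) P (f x).
  by move=> xd; apply: dP; rewrite ltr_norml; lra.
have [t0|t0] := leP 0 t.
  have [|||c cE E] := @increment_mvt R P f (x0 - d) (x0 + d) x0 (x0 + t) dP'.
  - by move: td; rewrite ltr_norml; lra.
  - by rewrite lerDl.
  - by move: td; rewrite ltr_norml; lra.
  exists (c - x0); last by rewrite E [x0 + (c - x0)]addrC subrK; ring.
  by rewrite !ger0_norm //; lra.
have [|||c cE E] := @increment_mvt R P f (x0 - d) (x0 + d) (x0 + t) x0 dP'.
- by move: td; rewrite ltr_norml; lra.
- by lra.
- by move: td; rewrite ltr_norml; lra.
exists (c - x0).
  by rewrite (ltr0_norm t0) ler_norml; lra.
by rewrite [x0 + (c - x0)]addrC subrK -opprB E; ring.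
Qed.

Lemma nbhs_box (x : R * R) (P : set (R * R)) : nbhs x P ->
  exists2 d : R, 0 < d & forall a b, `|a - x.1| < d -> `|b - x.2| < d -> P (a, b).
Proof.
move=> /nbhs_ballP[d /= d0 dP]; exists d => // a b ad bd.
by apply: dP; split; rewrite -ball_normE /= distrC.
Qed.

(** The partial derivatives are continuous, hence bounded near x; go from x to the
    nearby point along the two axes. *)
Lemma C1_lipschitz (U : set (R * R)) (g : R * R -> R) (x : R * R) :
  open U -> U x -> Cn_on 1 U g ->
  exists K d : R, [/\ 0 <= K, 0 < d & forall a b, `|a| < d -> `|b| < d ->
    U (x.1 + a, x.2 + b) /\ `|g (x.1 + a, x.2 + b) - g x| <= K * (`|a| + `|b|)].
Proof.
move=> oU Ux [_ Cg].
have [d1 [c1 _]] := Cg (1, 0) (or_introl erefl).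
have [d2 [c2 _]] := Cg (0, 1) (or_intror erefl).
have [d0 d00 dU] := nbhs_box (open_nbhs_nbhs (conj oU Ux)).
have bd v : {for x, continuous ('D_v g)} -> exists2 d : R, 0 < d & forall a b,
    `|a - x.1| < d -> `|b - x.2| < d -> `|'D_v g (a, b)| <= `|'D_v g x| + 1.
  move=> cv; have /cvgrPdist_lt /(_ 1 ltr01) /nbhs_box[d d0' H] := cv.
  exists d => // a b ad bd; have := H a b ad bd => /=.
  move=> h; have -> : 'D_v g (a, b) = 'D_v g x - ('D_v g x - 'D_v g (a, b)) by rewrite subKr.
  by apply: le_trans (ler_normB _ _) _; rewrite lerD2l ltW.
have [e1 e10 b1] := bd _ (c1 _ Ux).
have [e2 e20 b2] := bd _ (c2 _ Ux).
set K := Num.max (`|'D_(1, 0) g x| + 1) (`|'D_(0, 1) g x| + 1).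
exists K, (Num.min d0 (Num.min e1 e2)); split.
- by rewrite le_max addr_ge0.
- by rewrite !lt_min d00 e10.
move=> a b; rewrite !lt_min => /andP[a0 /andP[a1 a2]] /andP[b0 /andP[b10 b20]].
have xx (c y : R) : c + y - c = y by rewrite addrC addKr.
split; first by apply: dU => /=; rewrite xx.
have [||s1 s1a E1] := @mvt_signed (fun s => g (s, x.2)) (fun s => 'D_(1, 0) g (s, x.2)) x.1 (Num.min d0 e1) a.
- by move=> y; rewrite lt_min => /andP[yd _]; apply/is_derive_fst/d1/dU; rewrite ?subrr ?normr0.
- by rewrite lt_min a0.
have [||s2 s2b E2] := @mvt_signed (fun s => g (x.1 + a, s)) (fun s => 'D_(0, 1) g (x.1 + a, s)) x.2 (Num.min d0 e2) b.
- by move=> y; rewrite lt_min => /andP[yd _]; apply/is_derive_snd/d2/dU; rewrite ?xx.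
- by rewrite lt_min b0.
have -> : g (x.1 + a, x.2 + b) - g x =
   (g (x.1 + a, x.2 + b) - g (x.1 + a, x.2)) + (g (x.1 + a, x.2) - g (x.1, x.2)).
  by rewrite addrA subrK; case: (x).
rewrite /= in E1 E2; rewrite E1 E2 addrC mulrDr.
apply: le_trans (ler_normD _ _) _; rewrite !normrM lerD // ler_wpM2r //.
  apply: le_trans (b1 _ _ _ _) _; rewrite ?xx ?subrr ?normr0 //.
    exact: le_lt_trans a1.
  by rewrite le_max lexx.
apply: le_trans (b2 _ _ _ _) _; rewrite ?xx ?subrr ?normr0 //.
  exact: le_lt_trans b20.
by rewrite le_max lexx orbT.
Qed.

(** The mean value theorem along the two axes, with [C1_lipschitz] for the
    partial derivatives. *)
Lemma C2_taylor (U : set (R * R)) (g : R * R -> R) (x : R * R) :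
  open U -> U x -> Cn_on 2 U g ->
  exists K d : R, [/\ 0 <= K, 0 < d & forall a b, `|a| < d -> `|b| < d ->
    U (x.1 + a, x.2 + b) /\
    `|g (x.1 + a, x.2 + b) - g x - ('D_(1, 0) g x * a + 'D_(0, 1) g x * b)| <=
      K * (`|a| + `|b|) ^+ 2].
Proof.
move=> oU Ux [_ Cg].
have [d1 C1] := Cg (1, 0) (or_introl erefl).
have [d2 C2] := Cg (0, 1) (or_intror erefl).
have [K1 [e1 [K10 e10 H1]]] := C1_lipschitz oU Ux C1.
have [K2 [e2 [K20 e20 H2]]] := C1_lipschitz oU Ux C2.
exists (Num.max K1 K2), (Num.min e1 e2); split.
- by rewrite le_max K10.
- by rewrite lt_min e10.
move=> a b; rewrite !lt_min => /andP[a1 a2] /andP[b1 b2].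
have UU c d : `|c| < e1 -> `|d| < e1 -> U (x.1 + c, x.2 + d).
  by move=> c1 dd1; have [] := H1 c d c1 dd1.
split; first exact: UU.
have z1 : `|0 : R| < e1 by rewrite normr0.
have back (c y : R) : c + (y - c) = y by rewrite addrC subrK.
have [||s1 s1a E1] := @mvt_signed (fun s => g (s, x.2)) (fun s => 'D_(1, 0) g (s, x.2)) x.1 e1 a.
- by move=> y yd; apply/is_derive_fst/d1; have := UU _ _ yd z1; rewrite back addr0.
- by [].
have [||s2 s2b E2] := @mvt_signed (fun s => g (x.1 + a, s)) (fun s => 'D_(0, 1) g (x.1 + a, s)) x.2 e1 b.
- by move=> y yd; apply/is_derive_snd/d2; have := UU _ _ a1 yd; rewrite back.
- by [].
rewrite /= in E1 E2.
have -> : g (x.1 + a, x.2 + b) - g x - ('D_(1, 0) g x * a + 'D_(0, 1) g x * b) =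
   ('D_(1, 0) g (x.1 + s1, x.2) - 'D_(1, 0) g x) * a +
   ('D_(0, 1) g (x.1 + a, x.2 + s2) - 'D_(0, 1) g x) * b.
  rewrite !mulrBl -E1 -E2; have -> : g x = g (x.1, x.2) by case: (x).
  by ring.
have [_ h1] := H1 s1 0 (le_lt_trans s1a a1) z1.
have [_ h2] := H2 a s2 a2 (le_lt_trans s2b b2).
rewrite addr0 normr0 addr0 in h1.
apply: le_trans (ler_normD _ _) _; rewrite !normrM.
set na := `|a| in s1a h2 *; set nb := `|b| in s2b *.
have na0 : 0 <= na by rewrite normr_ge0.
have nb0 : 0 <= nb by rewrite normr_ge0.
have k1 : K1 <= Num.max K1 K2 by rewrite le_max lexx.
have k2 : K2 <= Num.max K1 K2 by rewrite le_max lexx orbT.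
set K := Num.max K1 K2 in k1 k2 *.
have K0 : 0 <= K by exact: le_trans k1.
have l1 : `|'D_(1, 0) g (x.1 + s1, x.2) - 'D_(1, 0) g x| <= K * na.
  by apply: le_trans h1 _; rewrite ler_pM.
have l2 : `|'D_(0, 1) g (x.1 + a, x.2 + s2) - 'D_(0, 1) g x| <= K * (na + nb).
  by apply: le_trans h2 _; rewrite ler_pM ?addr_ge0 ?lerD2l.
apply: le_trans (lerD (ler_wpM2r na0 l1) (ler_wpM2r nb0 l2)) _.
rewrite -subr_ge0.
have -> : K * (na + nb) ^+ 2 - (K * na * na + K * (na + nb) * nb) = K * (na * nb) by ring.
by rewrite !mulr_ge0.
Qed.

End Boundary.

(** * Tangent discs seen as half-planes *)

Section Tangent.
Variable R : realType.
Local Notation C := (Cplx R).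
Implicit Types (z w : C).

Lemma boundary_notin (D : set C) (p : C) : open D -> boundary D p -> ~ D p.
Proof. by rewrite openE => oD [_ pD] Dp; apply: pD; exact: oD. Qed.

Lemma Re_inv z : complex.Re z^-1 = complex.Re z / normc z ^+ 2.
Proof. by rewrite sqr_normcE; case: z. Qed.

Lemma normal_component (N a b x y : R) : N ^+ 2 = a ^+ 2 + b ^+ 2 -> N != 0 ->
  a * (- a * N^-1 * x - - b * N^-1 * y) + b * (- a * N^-1 * y + - b * N^-1 * x) =
  - (N * x).
Proof.
move=> NE N0; transitivity (- (N^-1 * (a ^+ 2 + b ^+ 2) * x)); first by ring.
by rewrite -NE; field.
Qed.

(** With z = p + nu zeta, [C2_taylor] reads r = - |grad r| Re zeta + O(|zeta|^2).
    As Re (1 / zeta) = Re zeta / |zeta|^2, this is |zeta|^2 times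
    - |grad r| Re (1 / zeta) + O(1): negative when Re (1 / zeta) is large, positive
    when it is very negative. Far from p the second inclusion holds because
    1 / zeta is bounded there. *)
Lemma boundary_tangent_half_planes (D : set C) (p : C) :
  open D -> boundary D p -> C2_boundary_near D p ->
  exists (nu : C) (A : R), [/\ normc nu = 1, 0 < A,
    (forall zeta : C, A < complex.Re zeta^-1 -> D (p + nu * zeta)) &
    (forall z, D z -> - A < complex.Re (nu / (z - p)))].
Proof.
move=> oD pD [U [r [[oU Up] Cr gr Dr]]].
have Dp := boundary_notin oD pD.
have [K [d [K0 d0 T]]] := C2_taylor oU Up Cr.
pose n : C := ('D_(1, 0) r (coords p) +i* 'D_(0, 1) r (coords p))%C.
have ng0 : 0 < normc n.
  rewrite normc_gt0; apply/eqP => n0; have := gr _ Up.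
  rewrite (_ : ('D_(1, 0) r (coords p), 'D_(0, 1) r (coords p)) = (0, 0)) ?eqxx //.
  by congr pair; [exact: (congr1 (@complex.Re R) n0)|exact: (congr1 (@complex.Im R) n0)].
pose nu : C := - n * ((normc n)^-1%:C)%C.
have nu1 : normc nu = 1.
  by rewrite /nu normcM normcN normcR ger0_norm ?invr_ge0 ?normc_ge0 // divff ?gt_eqF.
have nuR : complex.Re nu = - 'D_(1, 0) r (coords p) * (normc n)^-1.
  by rewrite /nu cReM cReN /= mulr0 subr0.
have nuI : complex.Im nu = - 'D_(0, 1) r (coords p) * (normc n)^-1.
  by rewrite /nu cImM cImN /= mulr0 add0r.
have nu0 : nu != 0 by rewrite -normc_eq0 nu1 oner_eq0.
have TC (zeta : C) : normc zeta < d -> U (coords (p + nu * zeta)) /\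
    `|r (coords (p + nu * zeta)) - r (coords p) + normc n * complex.Re zeta| <=
    4 * K * normc zeta ^+ 2.
  move=> zd; have nz : normc (nu * zeta) = normc zeta by rewrite normcM nu1 mul1r.
  have re := Re_normc (nu * zeta); have im := Im_normc (nu * zeta).
  rewrite nz in re im.
  have [h1 h2] := T _ _ (le_lt_trans re zd) (le_lt_trans im zd).
  have cE : coords (p + nu * zeta) =
     ((coords p).1 + complex.Re (nu * zeta), (coords p).2 + complex.Im (nu * zeta)).
    by rewrite /coords cReD cImD.
  rewrite cE; split=> //.
  have lin : 'D_(1, 0) r (coords p) * complex.Re (nu * zeta) +
      'D_(0, 1) r (coords p) * complex.Im (nu * zeta) = - (normc n * complex.Re zeta).
    have N0 : normc n != 0 by rewrite gt_eqF.
    rewrite cReM cImM nuR nuI.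
    exact: normal_component (sqr_normcE n) N0.
  rewrite lin opprK in h2; apply: le_trans h2 _.
  have -> : 4 * K * normc zeta ^+ 2 = K * (normc zeta + normc zeta) ^+ 2 by ring.
  by rewrite ler_wpM2l // ler_pXn2r ?nnegrE ?addr_ge0 ?normc_ge0 // lerD.
have rp : r (coords p) = 0.
  apply/eqP; rewrite eq_le; apply/andP; split; rewrite leNgt; apply/negP => r0; last first.
    by apply: Dp; apply/Dr.
  have [cr _] := Cr.
  have /cvgrPdist_lt /(_ _ r0) /nbhs_box[e e0 He] := cr _ Up.
  have [pD' _] := pD.
  have [|z [Dz /= ze]] := pD' [set z | normc (z - p) < Num.min d e].
    by apply/nbhs_normcP; exists (Num.min d e) => //; rewrite lt_min d0.
  move: ze; rewrite lt_min => /andP[zd ze].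
  have [z1 z2] : `|complex.Re z - complex.Re p| < e /\ `|complex.Im z - complex.Im p| < e.
    by split; apply: le_lt_trans ze; [exact: Re_lip|exact: Im_lip].
  have Uz : U (coords z).
    have [|+ _] := TC ((z - p) / nu).
      by rewrite normcM normcV nu1 invr1 mulr1.
    by rewrite mulrC divfK // addrC subrK.
  have := He _ _ z1 z2; have /Dr := Dz => /(_ Uz) rz.
  move=> /(le_lt_trans (ler_norm _)) /=.
  by rewrite -[X in X < _]opprB opprB ltrBlDr ltrDl ltNge (ltW rz).
have N0 : normc n != 0 by rewrite gt_eqF.
(* The summands serve, in this order, the quadratic error, the size of the
   neighbourhood where the expansion holds, and strictness. *)
pose A : R := 4 * K / normc n + d^-1 + 1.
have di0 : 0 < d^-1 by rewrite invr_gt0.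
have kn0 : 0 <= 4 * K / normc n by rewrite divr_ge0 ?mulr_ge0 // ltW.
have A0 : 0 < A by rewrite /A; move: kn0 di0; lra.
have Ad : d^-1 < A by rewrite /A; move: kn0; lra.
have An : 4 * K < A * normc n.
  by rewrite -ltr_pdivrMr // /A; move: di0; lra.
rewrite rp in TC.
exists nu, A; split=> // [zeta|z Dz].
- rewrite Re_inv => Az.
  have z0 : zeta != 0.
    apply/eqP => E; move: Az; rewrite E /= mul0r; move: A0; lra.
  have zn : 0 < normc zeta by rewrite normc_gt0.
  rewrite ltr_pdivlMr ?exprn_gt0 // in Az.
  have zd : normc zeta < d.
    have : A * normc zeta * normc zeta < normc zeta.
      by rewrite -mulrA -expr2; apply: lt_le_trans Az (le_trans (ler_norm _) (Re_normc _)).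
    rewrite -[X in _ < X]mul1r ltr_pM2r // => Az1.
    have : d^-1 * normc zeta < 1 by apply: le_lt_trans Az1; rewrite ler_pM2r // ltW.
    by rewrite mulrC ltr_pdivrMr // mul1r.
  have [Uz] := TC zeta zd; rewrite subr0 ler_norml => /andP[_ h].
  apply/Dr => //.
  have h2 : 4 * K * normc zeta ^+ 2 <= A * normc n * normc zeta ^+ 2.
    by rewrite ler_pM2r ?exprn_gt0 // ltW.
  have h3 : normc n * (A * normc zeta ^+ 2) < normc n * complex.Re zeta by rewrite ltr_pM2l.
  by move: h h2 h3; lra.
- pose zeta := (z - p) / nu.
  have zE : z = p + nu * zeta by rewrite /zeta mulrC divfK // addrC subrK.
  have -> : nu / (z - p) = zeta^-1 by rewrite /zeta invf_div.
  have z0 : zeta != 0.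
    by apply/eqP => E; apply: Dp; move: Dz; rewrite zE E mulr0 addr0.
  have zn : 0 < normc zeta by rewrite normc_gt0.
  have [zd|dz] := ltP (normc zeta) d; last first.
    have := Re_normc zeta^-1; rewrite normcV ler_norml => /andP[h _].
    apply: lt_le_trans h; rewrite ltrN2; apply: le_lt_trans Ad.
    by rewrite lef_pV2 ?posrE.
  have [Uz] := TC zeta zd; rewrite subr0 ler_norml => /andP[h _].
  have rz : r (coords z) < 0 by apply/Dr => //; rewrite zE.
  rewrite -zE in h.
  rewrite Re_inv ltr_pdivlMr ?exprn_gt0 //.
  rewrite -(ltr_pM2l ng0).
  have h2 : 4 * K * normc zeta ^+ 2 <= A * normc n * normc zeta ^+ 2.
    by rewrite ler_pM2r ?exprn_gt0 // ltW.
  by move: h h2 rz; lra.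
Qed.

End Tangent.

(** * Propagation over a connected open set *)

Section Propagation.
Variable R : realType.
Local Notation C := (Cplx R).
Implicit Types (z w : C) (D : set C).

(** The local hypothesis makes both P and its complement open in D. *)
Lemma connected_propagation D (P : C -> Prop) : open D -> connected D ->
  (exists2 z, D z & P z) ->
  (forall z, D z -> exists2 r : R, 0 < r &
     forall w w', normc (w - z) < r -> normc (w' - z) < r -> P w -> P w') ->
  forall z, D z -> P z.
Proof.
move=> oD cD [z0 Dz0 Pz0] loc.
have nP z : D z -> P z -> nbhs z P.
  move=> Dz Pz; apply/nbhs_normcP; have [r r0 H] := loc z Dz; exists r => // w wz.
  by apply: (H z w) => //; rewrite subrr normc0.
have nPC z : D z -> ~ P z -> nbhs z (~` P).
  move=> Dz Pz; apply/nbhs_normcP; have [r r0 H] := loc z Dz; exists r => // w wz Pw.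
  by apply: Pz; apply: (H w z) => //; rewrite subrr normc0.
have E : D `&` P = D.
  apply: cD.
  - by exists z0.
  - exists (D `&` P); last by rewrite setIA setIid.
    rewrite openE => z [Dz Pz]; apply: filterI; last exact: nP.
    by move: oD; rewrite openE; apply.
  - exists (~` (D `&` ~` P)); last first.
      rewrite setCI setCK setIUr setICr set0U //.
    apply: open_closedC; rewrite openE => z [Dz Pz]; apply: filterI; last exact: nPC.
    by move: oD; rewrite openE; apply.
by move=> z; rewrite -E => -[].
Qed.

Lemma identity_theorem D (g : C -> C) (z0 : C) (s0 : R) : open D -> connected D ->
  (forall z, D z -> derivable g z (1 : C)) -> D z0 -> 0 < s0 ->
  (forall z, normc (z - z0) < s0 -> g z = 0) -> forall z, D z -> g z = 0.
Proof.
move=> oD cD dg Dz0 s00 gz0.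
pose P z := exists2 s : R, 0 < s & forall w, normc (w - z) < s -> g w = 0.
suff H z : D z -> P z.
  move=> z Dz; have [s s1 ->] := H z Dz => //.
  by rewrite subrr normc0.
apply: connected_propagation => // {z}; first by exists z0 => //; exists s0.
move=> z Dz.
have [R1 R10 DR1] := openP_normc oD Dz.
have /continuous_normcP /(_ 1 ltr01) [R2 R20 gR2] := derivable_continuous (dg z Dz).
pose r := Num.min R1 R2.
have r1 : r <= R1 by rewrite ge_min lexx.
have r2 : r <= R2 by rewrite ge_min lexx orbT.
have r0 : 0 < r by rewrite lt_min R10.
exists (r / 4) => [|w w' wz w'z [s s1 gw]]; first by rewrite divr_gt0.
have tri a b c : normc (a - c) <= normc (a - b) + normc (b - c) :> R.
  have -> : a - c = (a - b) + (b - c) by rewrite addrA subrK.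
  exact: le_normcD.
have inz v : normc (v - w) < 3 * r / 4 -> normc (v - z) < r.
  by move=> vw; have := tri v w z; lra.
have Z : forall v, normc (v - w) < 3 * r / 4 -> g v = 0.
  apply: (@vanish_disc R g w (3 * r / 4) s (normc (g z) + 1)) => // v /inz vz.
    by apply/dg/DR1; lra.
  have := gR2 v (lt_le_trans vz r2).
  by have := normc_subr (g v) (g z); lra.
exists (r / 4) => [|v vw']; first by rewrite divr_gt0.
apply: Z; have := tri v w' w; have := tri w' z w; rewrite (normc_dist z w); lra.
Qed.

Lemma cvg_uniform_normc (K : set C) (F : nat -> C -> C) (l : C -> C) :
  (forall e : R, 0 < e -> \forall k \near \oo, forall z, K z -> normc (F k z - l z) < e) ->
  {uniform K, F @ \oo --> l}.
Proof.
move=> H P /uniform_nbhs[E [entE EP]].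
have [_/posnumP[e] eE] : exists2 e : R[i], 0 < e & [set xy : C * C | ball xy.1 e xy.2] `<=` E.
  by move: entE; rewrite -entourage_ballE => -[e /= e0 eE]; exists e.
have [eR e0] := gt0_complexE (gt0 e).
have := H _ e0; apply: filterS => k Hk; apply: EP => z Kz.
apply: eE; rewrite -ball_normE /=.
change (((normc (l z - F k z))%:C)%C < (e%:num : R[i])).
by rewrite eR ltcR normc_dist; exact: Hk.
Qed.

End Propagation.

(** * From the domain to the half-plane and back *)

Section Conjugation.
Variable R : realType.
Local Notation C := (Cplx R).
Implicit Types (z w : C).
Variables (D : set C) (p : C) (f : C -> C) (nu : C) (A : R).
Hypothesis oD : open D.
Hypothesis cD : connected D.
Hypothesis Dp : ~ D p.
Hypothesis bDp : boundary D p.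
Hypothesis fD : forall z, D z -> D (f z).
Hypothesis df : forall z, D z -> derivable f z (1 : C).
Hypothesis nu1 : normc nu = 1.
Hypothesis A0 : 0 < A.
Hypothesis inner : forall zeta : C, A < complex.Re zeta^-1 -> D (p + nu * zeta).
Hypothesis outer : forall z, D z -> - A < complex.Re (nu / (z - p)).
Hypothesis fp : nt_littleo D p (fun z => f z - z) (fun z => `|z - p|).

Let Ac : C := (A%:C)%C.
(** The map f^k read from D to the half-plane {Re w > 0}; in particular G 0 is the
    coordinate w itself, and Z is its inverse. *)
Let G k z : C := nu / (iter k f z - p) + Ac.
Let Z w : C := p + nu / (w - Ac).
Let Phi k w : C := G k (Z w).

Let nu0 : nu != 0. Proof. by rewrite -normc_eq0 nu1 oner_eq0. Qed.

Let iter_in k z : D z -> D (iter k f z).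
Proof. by move=> Dz; elim: k => //= k; exact: fD. Qed.

Let neqp z : D z -> z - p != 0.
Proof. by move=> Dz; rewrite subr_eq0; apply/eqP => E; apply: Dp; rewrite -E. Qed.

Let derivable_iter k z : D z -> derivable (iter k f) z (1 : C).
Proof.
move=> Dz; elim: k => [|k IH]; first exact: derivable_id.
exact: (@derivable_chain R f (iter k f) z IH (df (iter_in k Dz))).
Qed.

Let derivable_G k z : D z -> derivable (G k) z (1 : C).
Proof.
move=> Dz; apply: derivableD; last exact: derivable_cst.
apply: derivableM; first exact: derivable_cst.
apply: derivableV; first by apply: neqp; exact: iter_in.
by apply: derivableB; [exact: derivable_iter|exact: derivable_cst].
Qed.

Let G_gt0 k z : D z -> 0 < complex.Re (G k z).
Proof.
move=> Dz; rewrite /G cReD /=; have := outer (iter_in k Dz).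
by rewrite -subr_gt0 opprK.
Qed.

Let shift_neq0 w : 2 * A < complex.Re w -> w - Ac != 0.
Proof.
move=> wA; apply/eqP => /(congr1 (@complex.Re R)); rewrite cReD cReN /=.
by move: wA A0; lra.
Qed.

Let DZ w : 2 * A < complex.Re w -> D (Z w).
Proof.
move=> wA; apply: inner; rewrite invrK cReD cReN /=.
by move: wA A0; lra.
Qed.

Let Phi0 w : 2 * A < complex.Re w -> Phi 0 w = w.
Proof.
move=> wA; rewrite /Phi /G /Z /= [p + _]addrC addrK invf_div mulrC divfK //.
exact: subrK.
Qed.

Let ZG k z : D z -> Z (G k z) = iter k f z.
Proof.
move=> Dz; rewrite /Z /G addrK invf_div mulrC divfK //.
by rewrite addrC subrK.
Qed.

Let PhiD k l w : 2 * A < complex.Re w -> 2 * A < complex.Re (Phi k w) ->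
  Phi (k + l) w = Phi l (Phi k w).
Proof.
by move=> wA _; rewrite /Phi ZG; [rewrite /G addnC iterD|exact: DZ].
Qed.

Let dPhi k w : 2 * A < complex.Re w -> derivable (Phi k) w (1 : C).
Proof.
move=> wA; apply: (@derivable_chain R (G k) Z); last exact/derivable_G/DZ.
apply: derivableD; first exact: derivable_cst.
apply: derivableM; first exact: derivable_cst.
apply: derivableV; first exact: shift_neq0.
exact: derivable_sub.
Qed.

Let Phi_gt0 k w : 2 * A < complex.Re w -> 0 < complex.Re (Phi k w).
Proof. by move=> wA; apply/G_gt0/DZ. Qed.

Let displacement z : D z -> G 1 z - G 0 z = - nu * (f z - z) / ((f z - p) * (z - p)).
Proof.
move=> Dz; have h1 := neqp Dz; have h2 := neqp (fD Dz).
by rewrite /G /=; field; rewrite h1 h2.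
Qed.

Let cone_far (x : R) w : 100 * A < x -> normc (w - (x%:C)%C) <= x / 2 ->
  [/\ 2 * A < complex.Re w, (x / 2 - A) <= complex.Re (w - Ac),
      normc (w - Ac) <= 3 * x / 2 + A & x / 2 - A <= normc (w - Ac)].
Proof.
move=> xA wx.
have h1 : x / 2 - A <= complex.Re (w - Ac).
  by have := le_trans (Re_normc _) wx; rewrite !cReD !cReN /= ler_norml; lra.
split=> //.
- by move: h1 A0 xA; rewrite cReD cReN /=; lra.
- have -> : w - Ac = (w - (x%:C)%C) + ((x - A)%:C)%C.
    by apply: complex_ext; move: (w) => [a b] /=; ring.
  apply: le_trans (le_normcD _ _) _; rewrite normcR.
  have : `|x - A| <= x + A by rewrite ler_norml; apply/andP; split; move: A0 xA; lra.
  by move: wx; lra.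
- exact: le_trans h1 (Re_le_normc _).
Qed.

(** A disc around Z w of radius |Z w - p| / 10 is still contained in D, because
    in the coordinate w it stays inside the inner half-plane. As a point of the
    boundary is not in the open set D, this bounds the distance to the boundary
    from below. *)
Let cone_Gamma (x : R) w : 100 * A < x -> normc (w - (x%:C)%C) <= x / 2 ->
  Gamma D p 11 (Z w).
Proof.
move=> xA wx; have [wA re up lo] := cone_far xA wx.
split; first exact: DZ.
set v := w - Ac in re up lo.
have v0 : v != 0 by exact: shift_neq0.
have vn : 0 < normc v by rewrite normc_gt0.
have Zp : normc (Z w - p) = (normc v)^-1.
  by rewrite /Z [p + _]addrC addrK normcM normcV nu1 mul1r.
rewrite Zp.
suff : (normc v)^-1 / 10 <= dist (Z w) (boundary D).
  have : 0 < (normc v)^-1 by rewrite invr_gt0.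
  by lra.
apply: lb_le_inf; first by exists (normc (Z w - p)), p.
move=> _ [b [_ bD] <-]; rewrite leNgt; apply/negP => near.
suff Db : D b by apply: bD; move: oD; rewrite openE; apply.
pose h := (b - Z w) / nu.
have hn : normc h < (normc v)^-1 / 10.
  by rewrite /h normcM normcV nu1 invr1 mulr1 normc_dist.
have -> : b = p + nu * (v^-1 + h).
  rewrite mulrDr addrA -/v.
  have -> : p + nu / v = Z w by [].
  by rewrite /h mulrCA divff // mulr1 addrC subrK.
apply: inner; rewrite Re_inv.
set i := (normc v)^-1 in hn.
have i0 : 0 < i by rewrite invr_gt0.
have vi : normc v * i = 1 by rewrite divff // gt_eqF.
(* In the cone Re v / |v| is at least (1/2 - 1/100) / (3/2 + 1/100) > 32/100. *)
have re1 : 32 / 100 * i <= complex.Re v^-1.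
  rewrite Re_inv -(ler_pM2r (exprn_gt0 2 vn)) divfK ?expf_neq0 ?gt_eqF //.
  have -> : 32 / 100 * i * normc v ^+ 2 = 32 / 100 * normc v * (normc v * i) by ring.
  by rewrite vi mulr1; move: re up xA A0; lra.
have re2 : 22 / 100 * i <= complex.Re (v^-1 + h).
  rewrite cReD; have := le_trans (Re_normc h) (ltW hn).
  by rewrite ler_norml; move: re1; lra.
have n1 : normc (v^-1 + h) <= 11 / 10 * i.
  apply: le_trans (le_normcD _ _) _; rewrite normcV -/i; move: hn; lra.
have n0 : 0 < normc (v^-1 + h).
  by apply: lt_le_trans (Re_le_normc _); apply: lt_le_trans re2; move: i0; lra.
rewrite ltr_pdivlMr ?exprn_gt0 //.
have n2 : normc (v^-1 + h) ^+ 2 <= (11 / 10 * i) ^+ 2.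
  by rewrite ler_pXn2r // nnegrE ?normc_ge0 // mulr_ge0 // ltW.
apply: lt_le_trans re2; apply: le_lt_trans (ler_wpM2l (ltW A0) n2) _.
have -> : A * (11 / 10 * i) ^+ 2 = 121 / 100 * (A * i) * i by field.
rewrite ltr_pM2r //.
have : A * i < 1 / 49.
  by rewrite -(ltr_pM2r vn) -mulrA [i * _]mulrC vi mulr1; move: lo xA; lra.
by lra.
Qed.

Let Z_near (e : R) : 0 < e -> exists X : R, 100 * A <= X /\ forall (x : R) w, X < x ->
  normc (w - (x%:C)%C) <= x / 2 -> normc (Z w - p) < e.
Proof.
move=> e0; exists (100 * A + 4 / e); split; first by rewrite lerDl divr_ge0 // ltW.
move=> x w xX wx.
have xA : 100 * A < x by apply: le_lt_trans xX; rewrite lerDl divr_ge0 // ltW.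
have [wA re up lo] := cone_far xA wx.
have vn : 0 < normc (w - Ac) by rewrite normc_gt0 shift_neq0.
rewrite /Z [p + _]addrC addrK normcM normcV nu1 mul1r.
rewrite -[X in _ < X]invrK ltf_pV2 ?posrE ?invr_gt0 //.
have : 0 < e^-1 by rewrite invr_gt0.
by move: lo xX A0; lra.
Qed.

Let cone_step (e : R) : 0 < e -> exists X : R, 100 * A <= X /\ forall (x : R) w, X < x ->
  normc (w - (x%:C)%C) <= x / 2 -> normc (f (Z w) - Z w) <= e * normc (Z w - p).
Proof.
move=> e0.
have M1 : 1 < 11 :> R by rewrite ltr1n.
have := fp M1.
move/(@cvg_normcP _ _ (nontangential D p 11) _ _ 0) => /(_ e e0).
rewrite near_withinE => /nbhs_normcP[r r0 H].
have [X [XA HX]] := Z_near r0.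
exists X; split=> // x w xX wx.
have xA : 100 * A < x by exact: le_lt_trans xX.
have [wA _ _ _] := cone_far xA wx.
have := H (Z w) (HX x w xX wx) (cone_Gamma xA wx).
have zn : 0 < normc (Z w - p) by rewrite normc_gt0; apply/neqp/DZ.
have -> : `|Z w - p| = ((normc (Z w - p))%:C)%C :> C by [].
rewrite subr0 normcM normcV normcR (gtr0_norm zn) ltr_pdivrMr //; exact: ltW.
Qed.

Let Z_dist w : 2 * A < complex.Re w -> normc (Z w - p) * normc (w - Ac) = 1.
Proof.
move=> wA; have vn : normc (w - Ac) != 0 by rewrite normc_eq0 shift_neq0.
by rewrite /Z [p + _]addrC addrK normcM normcV nu1 mul1r mulVf.
Qed.

Let displacement_normc w : 2 * A < complex.Re w ->
  normc (Phi 1 w - w) * (normc (f (Z w) - p) * normc (Z w - p)) = normc (f (Z w) - Z w).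
Proof.
move=> wA; have Dz := DZ wA.
have -> : Phi 1 w - w = G 1 (Z w) - G 0 (Z w).
  by rewrite -[in X in _ - X](Phi0 wA).
rewrite displacement // !normcM normcV normcM normcN nu1 mul1r divfK //.
by apply: mulf_neq0; rewrite normc_eq0; apply: neqp => //; exact: fD.
Qed.

(** The hypothesis f z = z + o(|z - p|), read in the coordinate w. *)
Let cone_displacement (e : R) : 0 < e -> exists X : R, 100 * A <= X /\ forall (x : R) w, X < x ->
  normc (w - (x%:C)%C) <= x / 2 -> normc (Phi 1 w - w) <= e * x.
Proof.
move=> e0; pose e1 := Num.min (1 / 2) (e / 4).
have e10 : 0 < e1 by rewrite lt_min !divr_gt0.
have e12 : e1 <= 1 / 2 by rewrite ge_min lexx.
have e14 : e1 <= e / 4 by rewrite ge_min lexx orbT.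
have [X [XA HX]] := cone_step e10; exists X; split=> // x w xX wx.
have xA : 100 * A < x by exact: le_lt_trans xX.
have [wA _ up _] := cone_far xA wx.
have st := HX x w xX wx.
have zn : 0 < normc (Z w - p) by rewrite normc_gt0; apply/neqp/DZ.
have fz : normc (Z w - p) / 2 <= normc (f (Z w) - p).
  have := normc_subr (Z w - p) (Z w - f (Z w)).
  have -> : Z w - p - (Z w - f (Z w)) = f (Z w) - p by ring.
  rewrite (normc_dist (Z w) (f (Z w))).
  have : e1 * normc (Z w - p) <= 1 / 2 * normc (Z w - p) by rewrite ler_pM2r.
  by move: st; lra.
have fz0 : 0 < normc (f (Z w) - p) by apply: lt_le_trans fz; rewrite divr_gt0.
have h1 : normc (Phi 1 w - w) * (normc (Z w - p) / 2) <= e1.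
  rewrite -(ler_pM2r zn); apply: le_trans st; rewrite -(displacement_normc wA) -mulrA.
  by rewrite ler_wpM2l ?normc_ge0 // ler_pM2r.
have zd := Z_dist wA.
have vn : 0 < normc (w - Ac) by rewrite normc_gt0 shift_neq0.
have h2 : normc (Phi 1 w - w) <= 2 * e1 * normc (w - Ac).
  have := ler_wpM2r (ltW vn) h1.
  have -> : normc (Phi 1 w - w) * (normc (Z w - p) / 2) * normc (w - Ac) =
    normc (Phi 1 w - w) / 2 * (normc (Z w - p) * normc (w - Ac)) by ring.
  by rewrite zd mulr1; lra.
apply: le_trans h2 _.
have x0 : 0 < x by move: xA A0; lra.
have : e1 * normc (w - Ac) <= e / 4 * (2 * x).
  apply: ler_pM => //; [exact: ltW|exact: normc_ge0|move: up xA A0; lra].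
by lra.
Qed.

Let Phi_asym k (e : R) : 0 < e -> exists X : R, forall x : R, X < x ->
  normc (Phi k (x%:C)%C - (x%:C)%C) <= e * x.
Proof.
elim: k e => [|k IH] e e0.
  exists (100 * A) => x xA; rewrite Phi0; last by rewrite /=; move: xA A0; lra.
  by rewrite subrr normc0 mulr_ge0 ?(ltW e0) //; move: xA A0; lra.
pose e1 := Num.min (1 / 2) (e / 2).
have e10 : 0 < e1 by rewrite lt_min !divr_gt0.
have e12 : e1 <= 1 / 2 by rewrite ge_min lexx.
have e14 : e1 <= e / 2 by rewrite ge_min lexx orbT.
have [X1 H1] := IH _ e10.
have [X2 [X2A H2]] := cone_displacement (divr_gt0 e0 (ltr0n R 2)).
exists (Num.max X1 X2) => x; rewrite gt_max => /andP[x1 x2].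
have xA : 100 * A < x by exact: le_lt_trans x2.
have x0 : 0 < x by move: xA A0; lra.
have h1 := H1 x x1.
have h2 : normc (Phi k (x%:C)%C - (x%:C)%C) <= x / 2.
  by apply: le_trans h1 _; rewrite [leRHS]mulrC -[_^-1]mul1r ler_pM2r.
have h3 := H2 x _ x2 h2.
have [kA _ _ _] := cone_far xA h2.
have xA2 : 2 * A < complex.Re (x%:C)%C by rewrite /=; move: xA A0; lra.
rewrite -addn1 (@PhiD k 1 (x%:C)%C xA2 kA).
have -> : Phi 1 (Phi k (x%:C)%C) - (x%:C)%C =
  (Phi 1 (Phi k (x%:C)%C) - Phi k (x%:C)%C) + (Phi k (x%:C)%C - (x%:C)%C).
  by rewrite addrA subrK.
apply: le_trans (le_normcD _ _) _.
have : e1 * x <= e / 2 * x by rewrite ler_pM2r.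
by move: h1 h3; lra.
Qed.

Let A20 : 0 <= 2 * A. Proof. by rewrite mulr_ge0 // ltW. Qed.

(** Fixed points of Phi 1 near y are fixed points of f near Z y. *)
Let locally_identity y (r : R) : 0 < r ->
  (forall y', normc (y' - y) < r -> 2 * A < complex.Re y') ->
  (forall y', normc (y' - y) < r -> Phi 1 y' = y') -> forall z, D z -> f z = z.
Proof.
move=> r0 yA fixy.
have yA0 : 2 * A < complex.Re y by apply: yA; rewrite subrr normc0.
have Dy := DZ yA0.
have /continuous_normcP /(_ r r0)[s s0 Hs] := derivable_continuous (@derivable_G 0 _ Dy).
have [s' s'0 Ds] := openP_normc oD Dy.
suff H z : D z -> f z - z = 0 by move=> z /H/eqP; rewrite subr_eq0 => /eqP.
refine (@identity_theorem R D (fun z => f z - z) (Z y) (Num.min s s') oD cD _ Dy _ _ z).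
- by move=> v Dv; apply: derivableB; [exact: df|exact: derivable_id].
- by rewrite lt_min s0.
move=> {}z; rewrite lt_min => /andP[zs zs'].
have Dz := Ds z zs'.
have := Hs z zs; rewrite -/(Phi 0 y) Phi0 // => zy.
have := fixy _ zy; rewrite /Phi ZG // => E.
have : Z (G 1 z) = Z (G 0 z) by rewrite -E.
by rewrite !ZG //= => ->; rewrite subrr.
Qed.

Hypothesis f_nonid : ~ (forall z, D z -> f z = z).

Let escape_ray : exists X : R, forall x : R, X < x -> forall M : R,
  exists N, forall k, (N <= k)%N -> M < normc (Phi k (x%:C)%C).
Proof.
have [X HX] := bounded_orbit_fixed A20 dPhi Phi_gt0 Phi0 PhiD Phi_asym.
exists X => x xX M; apply: contrapT => H.
have [|y [r [r0 yA fixy]]] := HX x xX.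
  exists M => N; apply: contrapT => H2; apply: H; exists N => k Nk.
  by rewrite ltNge; apply/negP => kM; apply: H2; exists k.
by apply: f_nonid; exact: (locally_identity r0 yA fixy).
Qed.

(** [schwarz_pick_disc] for G k with |w - z| / r <= 1/2, as (1 + 1/2) / (1 - 1/2) = 3. *)
Let G_harnack z (r : R) : 0 < r -> (forall w, normc (w - z) < r -> D w) ->
  forall k w, normc (w - z) <= r / 2 -> normc (G k z) <= 3 * normc (G k w).
Proof.
move=> r0 Dr k w wr.
have wr' : normc (w - z) < r by apply: le_lt_trans wr _; rewrite ltr_pdivrMr //; lra.
have := @schwarz_pick_disc R (G k) z r (fun v vr => @derivable_G k v (Dr v vr))
  (fun v vr => @G_gt0 k v (Dr v vr)) w wr'.
have := le_normcD (G k w) ((G k z)^*)%C; rewrite cnormJ => h1 h2.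
have {}h2 : r * normc (G k w - G k z) <= r * (1 / 2 * (normc (G k w) + normc (G k z))).
  apply: le_trans h2 _.
  have -> : r * (1 / 2 * (normc (G k w) + normc (G k z))) = r / 2 * (normc (G k w) + normc (G k z)).
    by field.
  by rewrite ler_pM ?normc_ge0.
rewrite ler_pM2l // in h2.
by have := normc_subr (G k z) (G k w); rewrite normc_dist; lra.
Qed.

Let escape z : D z -> forall M : R, exists N, forall k, (N <= k)%N -> M < normc (G k z).
Proof.
move: z; apply: connected_propagation => //.
  have [X HX] := escape_ray.
  pose x := Num.max (X + 1) (2 * A + 1).
  exists (Z (x%:C)%C).
    by apply: DZ; rewrite /= /x lt_max ltrDl ltr01 orbT.
  by move=> M; have [|N HN] := HX x _ M; [rewrite /x lt_max ltrDl ltr01|exists N].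
move=> z Dz; have [r r0 Dr] := openP_normc oD Dz.
exists (r / 8) => [|w w' wz w'z HM M]; first by rewrite divr_gt0.
have [N HN] := HM (3 * M); exists N => k Nk.
have tri a b c : normc (a - c) <= normc (a - b) + normc (b - c) :> R.
  have -> : a - c = (a - b) + (b - c) by rewrite addrA subrK.
  exact: le_normcD.
have r30 : 0 < 3 * r / 4 by rewrite divr_gt0 // mulr_gt0.
have Dw v : normc (v - w) < 3 * r / 4 -> D v.
  by move=> vw; apply: Dr; have := tri v w z; move: wz; lra.
have ww' : normc (w' - w) <= 3 * r / 4 / 2.
  by have := tri w' z w; rewrite (normc_dist z w); move: wz w'z r0; lra.
have := G_harnack r30 Dw k ww'; have := HN k Nk; lra.
Qed.

(** |f^k w - p| = 1 / |G k w - A|, and G k tends to infinity uniformly near every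
    point of D. *)
Lemma iterates_cvg : cvg_unif_on_compacts D (fun k => iter k f) (cst p).
Proof.
move=> K cK KD; apply: cvg_uniform_normc => e e0.
move/compact_near_coveringP : cK => cK.
apply: (cK nat \oo (fun k z => normc (iter k f z - cst p z) < e)) => z Kz.
have Dz := KD z Kz; have [r r0 Dr] := openP_normc oD Dz.
have [N HN] := escape Dz (3 * (A + e^-1)).
exists ([set w | normc (w - z) < r / 2], [set k | (N <= k)%N]) => /=.
  split; last by exists N.
  by apply/nbhs_normcP; exists (r / 2) => //; rewrite divr_gt0.
move=> [w k] /= [wr Nk].
have Dw : D w by apply: Dr; move: wr r0; lra.
have h1 := G_harnack r0 Dr k (ltW wr); have h2 := HN k Nk.
have k0 := neqp (iter_in k Dw).
have n0 : 0 < normc (iter k f w - p) by rewrite normc_gt0.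
have h3 : normc (G k w - Ac) = (normc (iter k f w - p))^-1.
  by rewrite /G addrK normcM normcV nu1 mul1r.
have h4 := normc_subr (G k w) Ac.
rewrite h3 normcR gtr0_norm // in h4.
rewrite -ltf_pV2 ?posrE //.
by move: h1 h2 h4; lra.
Qed.

(** At z = Z x the quotient equals |Phi 1 x - x| |f z - p| / |z - p|^2, where
    |f z - p| >= |z - p| / 2 and 1 / |z - p| = x - A >= x / 2. So it is at least
    c / 4 at points of the real axis that accumulate at p. *)
Lemma limsup_cubic : nt_limsup_pos D p (fun z => normc (f z - z) / normc (z - p) ^+ 3).
Proof.
have [|c c0 Hc] := displacement_lower_bound A20 dPhi Phi_gt0 Phi0 PhiD Phi_asym.
  have [X HX] := escape_ray; exists X => x xX M.
  by have [N HN] := HX x xX M; exists N; exact: HN.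
exists 11; first by rewrite ltr1n.
apply: (@lt_le_trans _ _ (c / 4)%:E); first by rewrite lte_fin divr_gt0.
rewrite /limf_esup; apply: le_ereal_inf_tmp => _ [V FV <-].
move: FV; rewrite /nontangential /within /= => /nbhs_normcP[r r0 rV].
have [X1 [X1A H1]] := Z_near r0.
have half : 0 < 1 / 2 :> R by rewrite divr_gt0.
have [X2 [X2A H2]] := cone_step half.
have [x xX cx] := Hc (Num.max X1 X2).
move: xX; rewrite gt_max => /andP[x1 x2].
have xA : 100 * A < x by exact: le_lt_trans x1.
have x0 : 0 < x by move: xA A0; lra.
set w : C := (x%:C)%C in cx.
have ww : normc (w - w) <= x / 2.
  by rewrite subrr normc0 divr_ge0 // ltW.
have wA : 2 * A < complex.Re w by rewrite /=; move: xA A0; lra.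
have Dz := DZ wA.
apply: le_trans (_ : ((normc (f (Z w) - Z w) / normc (Z w - p) ^+ 3)%:E <= _)%E); last first.
  apply: ereal_sup_ubound; exists (Z w) => //; apply: rV; first exact: H1 ww.
  exact: cone_Gamma ww.
rewrite lee_fin.
have st := H2 x w x2 ww.
have zn : 0 < normc (Z w - p) by rewrite normc_gt0; exact: neqp.
have fz : normc (Z w - p) / 2 <= normc (f (Z w) - p).
  have := normc_subr (Z w - p) (Z w - f (Z w)).
  have -> : Z w - p - (Z w - f (Z w)) = f (Z w) - p by ring.
  by rewrite (normc_dist (Z w) (f (Z w))); move: st; lra.
rewrite -(displacement_normc wA).
have zd := Z_dist wA.
have wAc : normc (w - Ac) = x - A.
  have -> : w - Ac = ((x - A)%:C)%C by apply: complex_ext => /=; ring.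
  by rewrite normcR ger0_norm //; move: xA A0; lra.
rewrite wAc in zd.
have P0 := normc_ge0 (Phi 1 w - w).
rewrite ler_pdivlMr ?exprn_gt0 //.
apply: le_trans (_ : _ <= normc (Phi 1 w - w) * (normc (Z w - p) / 2 * normc (Z w - p))) _; last first.
  by rewrite ler_wpM2l // ler_pM2r.
have -> : normc (Phi 1 w - w) * (normc (Z w - p) / 2 * normc (Z w - p)) =
    (x - A) * normc (Phi 1 w - w) / 2 * normc (Z w - p) ^+ 3.
  have -> : (x - A) * normc (Phi 1 w - w) / 2 * normc (Z w - p) ^+ 3 =
    normc (Z w - p) * (x - A) * (normc (Phi 1 w - w) * (normc (Z w - p) / 2 * normc (Z w - p))) by field.
  by rewrite zd mul1r.
rewrite ler_pM2r ?exprn_gt0 //.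
have : x / 2 * normc (Phi 1 w - w) <= (x - A) * normc (Phi 1 w - w).
  by rewrite ler_wpM2r //; move: xA A0; lra.
by move: cx; lra.
Qed.

End Conjugation.

Theorem theorem2p7 (R : realType) (D : set (Cplx R)) (p : Cplx R)
    (f : Cplx R -> Cplx R)
    (hD : domain D) (hp : boundary D p) (hC2 : C2_boundary_near D p)
    (hfD : forall z, D z -> D (f z)) (hf : holomorphic_on D f)
    (hfp : nt_littleo D p (fun z => f z - z) (fun z => `|z - p|)) :
  (forall z, D z -> f z = z) \/
  (cvg_unif_on_compacts D (fun k => iter k f) (cst p) /\
   nt_limsup_pos D p (fun z => normc (f z - z) / normc (z - p) ^+ 3)).
Proof.
have [_ oD cD] := hD.
have [|nid] := pselect (forall z, D z -> f z = z); first by left.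
right.
have Dp := boundary_notin oD hp.
have [nu [A [nu1 A0 inner outer]]] := boundary_tangent_half_planes oD hp hC2.
split; first exact: (iterates_cvg oD cD Dp hp hfD hf nu1 A0 inner outer hfp nid).
exact: (limsup_cubic oD cD Dp hp hfD hf nu1 A0 inner outer hfp nid).
Qed.
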